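(* Let $X$ be a real Banach space containing an isomorphic copy of $c_0$. Then there exists an equivalent norm $|\cdot|$ on $X$ such that $(X,|\cdot|)$ has the uniform slice diameter two property and such that, for every $\eta>0$, the unit ball of $(X,|\cdot|)$ contains a non-empty relatively weakly open subset whose diameter (with respect to $|\cdot|$) is smaller than $\eta$.
   Context: All Banach spaces are real; $B_X$ denotes the closed unit ball of $X$ and $X^*$ its topological dual. A slice of a bounded set $C\subseteq X$ is a set $S(C,f,\alpha)=\{x\in C: f(x)>\sup f(C)-\alpha\}$ with $f\in X^*$ and $\alpha>0$. A Banach space $X$ has the slice diameter two property (slice-D2P) if every slice of $B_X$ has diameter two. Given a free ultrafilter $\mathcal U$ over $\mathbb N$, the ultrapower $X_{\mathcal U}$ is the quotient Banach space $\ell_\infty(\mathbb N,X)/c_{0,\mathcal U}(\mathbb N,X)$, where $\ell_\infty(\mathbb N,X)$ is the space of bounded sequences in $X$ with the supremum norm and $c_{0,\mathcal U}(\mathbb N,X)=\{(x_n)\in\ell_\infty(\mathbb N,X): \lim_{\mathcal U}\|x_n\|=0\}$; its norm is $\|[x_n]\|=\lim_{\mathcal U}\|x_n\|$. A Banach space $X$ has the uniform slice diameter two property (uniform slice-D2P) if $X_{\mathcal U}$ has the slice-D2P for every free ultrafilter $\mathcal U$ over $\mathbb N$. *)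

(* Defs.v *)
From HB Require Import structures.
From mathcomp Require Import all_boot all_order all_algebra.
From mathcomp Require Import generic_quotient ring_quotient.
From mathcomp Require Import all_classical all_reals all_analysis.

Set Implicit Arguments.
Unset Strict Implicit.
Unset Printing Implicit Defensive.

Import Order.TTheory GRing.Theory Num.Theory.
Import numFieldNormedType.Exports.

Local Open Scope classical_set_scope.
Local Open Scope ring_scope.
Local Open Scope quotient_scope.

Section Geometry.
Context {R : realType}.

Definition dual (V : normedModType R) : Type :=
  {f : {linear V -> R^o} | continuous f}.

Definition unit_ball (V : normedModType R) : set V := [set x | `|x| <= 1].

Definition slice (V : normedModType R) (C : set V) (f : dual V) (alpha : R) :
    set V :=
  [set x | C x /\ sval f x > sup (sval f @` C) - alpha].

(* diam set0 = -oo, so "diam A < eta" alone does not make A nonempty. *)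
Definition diam (V : normedModType R) (A : set V) : \bar R :=
  ereal_sup [set `|x - y|%:E | x in A & y in A].

Definition slice_D2P (V : normedModType R) : Prop :=
  forall (f : dual V) (alpha : R), 0 < alpha ->
    diam (slice (@unit_ball V) f alpha) = 2%:E.

Definition weak_topology (V : normedModType R) : topologicalType :=
  sup_topology (fun f : dual V =>
    Topological.on (initial_topology (sval f : V -> R^o))).

Definition weakly_open (V : normedModType R) (W : set V) : Prop :=
  @open (weak_topology V) W.

Definition rel_weakly_open (V : normedModType R) (C A : set V) : Prop :=
  exists2 W : set V, weakly_open W & A = W `&` C.

End Geometry.

Section Ellinfty.
Context {R : realType} (V : normedModType R).

Definition ell_infty_pred : pred (nat -> V) :=
  [pred x | `[< exists M : R, forall n, `|x n| <= M >]].

Fact ell_infty_submod_closed : submod_closed ell_infty_pred.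
Proof.
split=> [|a x y].
  by apply/asboolP; exists 0 => n; rewrite normr0.
move=> /asboolP[M xM] /asboolP[N yN]; apply/asboolP.
exists (`|a| * M + N) => n; apply: (le_trans (ler_normD _ _)).
by rewrite lerD// normrZ ler_wpM2l.
Qed.

HB.instance Definition _ :=
  GRing.isSubmodClosed.Build R (nat -> V) ell_infty_pred
    ell_infty_submod_closed.

Record ell_infty := EllInfty {
  ell_seq :> nat -> V;
  ell_seqP : ell_infty_pred ell_seq }.

HB.instance Definition _ := [isSub for ell_seq].
HB.instance Definition _ := [Choice of ell_infty by <:].
HB.instance Definition _ := [SubChoice_isSubLmodule of ell_infty by <:].

Definition ell_norm (x : ell_infty) : R := sup (range (fun n => `|x n|)).

Lemma ell_norm_has_sup (x : ell_infty) : has_sup (range (fun n => `|x n|)).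
Proof.
split; first by exists `|x 0%N|, 0%N.
by have /asboolP[M xM] := ell_seqP x; exists M => _ [n _ <-].
Qed.

Lemma ell_norm_ge (x : ell_infty) n : `|x n| <= ell_norm x.
Proof. by apply: sup_upper_bound; [exact: ell_norm_has_sup|exists n]. Qed.

Lemma ell_norm_le (x : ell_infty) M :
  (forall n, `|x n| <= M) -> ell_norm x <= M.
Proof.
move=> xM; apply: ge_sup; first by exists `|x 0%N|, 0%N.
by move=> _ [n _ <-].
Qed.

Fact ell_normD x y : ell_norm (x + y) <= ell_norm x + ell_norm y.
Proof.
apply: ell_norm_le => n; apply: (le_trans (ler_normD _ _)).
by rewrite lerD// ell_norm_ge.
Qed.

Fact ell_normZ (a : R) x : ell_norm (a *: x) = `|a| * ell_norm x.
Proof.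
apply/eqP; rewrite eq_le; apply/andP; split.
  by apply: ell_norm_le => n /=; rewrite normrZ ler_wpM2l// ell_norm_ge.
have [->|a0] := eqVneq a 0.
  by rewrite normr0 mul0r (le_trans _ (ell_norm_ge _ 0%N)).
rewrite -ler_pdivlMl ?normr_gt0//; apply: ell_norm_le => n.
rewrite ler_pdivlMl ?normr_gt0// -normrZ.
exact: (ell_norm_ge (a *: x) n).
Qed.

Fact ell_norm0_eq0 x : ell_norm x = 0 -> x = 0.
Proof.
move=> x0; apply: val_inj; apply/funext => n /=.
by apply/normr0_eq0/eqP; rewrite eq_le normr_ge0 andbT -x0 ell_norm_ge.
Qed.

HB.instance Definition _ :=
  Lmodule_isNormed.Build R ell_infty ell_normD ell_normZ ell_norm0_eq0.

End Ellinfty.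

Section C0.
Context (R : realType).

Definition c0_pred : pred (ell_infty R^o) :=
  [pred x : ell_infty R^o | `[< (x n : R^o) @[n --> \oo] --> (0 : R^o) >]].

Fact c0_submod_closed : submod_closed c0_pred.
Proof.
split=> [|a x y].
  by apply/asboolP; exact: cvg_cst.
move=> /asboolP x0 /asboolP y0; apply/asboolP.
have : (a *: (x n : R^o) + y n) @[n --> \oo] --> (a *: (0 : R^o) + 0).
  by apply: cvgD => //; exact: cvgZr.
by rewrite scaler0 addr0.
Qed.

HB.instance Definition _ :=
  GRing.isSubmodClosed.Build R (ell_infty R^o) c0_pred c0_submod_closed.

Record c0 := C0 { c0_seq :> ell_infty R^o; c0_seqP : c0_pred c0_seq }.

HB.instance Definition _ := [isSub for c0_seq].
HB.instance Definition _ := [Choice of c0 by <:].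
HB.instance Definition _ := [SubChoice_isSubLmodule of c0 by <:].

Definition c0_norm (x : c0) : R := `|c0_seq x|.

Fact c0_normD x y : c0_norm (x + y) <= c0_norm x + c0_norm y.
Proof. exact: ler_normD. Qed.

Fact c0_normZ (a : R) x : c0_norm (a *: x) = `|a| * c0_norm x.
Proof. exact: normrZ. Qed.

Fact c0_norm0_eq0 x : c0_norm x = 0 -> x = 0.
Proof. by move=> /normr0_eq0 x0; exact: val_inj. Qed.

HB.instance Definition _ :=
  Lmodule_isNormed.Build R c0 c0_normD c0_normZ c0_norm0_eq0.

End C0.

Definition contains_isomorphic_copy {R : realType} (E V : normedModType R) :
    Prop :=
  exists T : {linear E -> V}, exists a b : R,
    [/\ 0 < a, 0 < b & forall x, a * `|x| <= `|T x| <= b * `|x|].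

Structure free_ultrafilter := FreeUltrafilter {
  fultra :> set_system nat;
  fultra_ultra : UltraFilter fultra;
  fultra_free : \bigcap_(A in fultra) A = set0 }.

#[global] Existing Instance fultra_ultra.

Section Ultrapower.
Context {R : realType} (U : free_ultrafilter) (V : normedModType R).

Lemma ultralim_is_cvg (x : ell_infty V) : cvg (`|x n| @[n --> fultra U]).
Proof.
have /asboolP[M xM] := ell_seqP x.
have UF : UltraFilter (`|x n| @[n --> fultra U]).
  split; first exact: fmap_proper_filter.
  move=> G GF UG; apply/seteqP; split; last exact: UG.
  move=> A GA.
  have [//|UA] := in_ultra_setVsetC ((fun n => `|x n|) @^-1` A)
    (fultra_ultra U).
  have /filterI/(_ GA) : G (~` A) by exact: UG.
  by rewrite setICl => /filter_not_empty.
have := @segment_compact R 0 M; rewrite compact_ultra => /(_ _ UF).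
case; first by apply: nearW => n; rewrite /= in_itv/= normr_ge0 xM.
by move=> l [_ xl]; apply/cvg_ex; exists l.
Qed.
Arguments ultralim_is_cvg : clear implicits.

Definition c0U_pred : pred (ell_infty V) :=
  [pred x : ell_infty V | `[< `|x n| @[n --> fultra U] --> (0 : R) >]].

Fact c0U_submod_closed : submod_closed c0U_pred.
Proof.
split=> [|a x y].
  apply/asboolP; under eq_fun do rewrite /= normr0.
  exact: cvg_cst.
move=> /asboolP x0 /asboolP y0; apply/asboolP.
have axy0 : `|a| * `|x n| + `|y n| @[n --> fultra U] --> (0 : R).
  rewrite -(addr0 0) -[X in X + _](mulr0 `|a|).
  by apply: cvgD => //; apply: cvgMr.
apply: (squeeze_cvgr _ (cvg_cst 0) axy0).
apply: nearW => n; rewrite normr_ge0/= -normrZ; exact: ler_normD.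
Qed.

HB.instance Definition _ :=
  GRing.isSubmodClosed.Build R (ell_infty V) c0U_pred c0U_submod_closed.

Definition c0U : zmodClosed (ell_infty V) :=
  GRing.ZmodClosed.clone (ell_infty V) c0U_pred _.

Definition ultrapower : Type := Quotient.quot c0U.

HB.instance Definition _ := GRing.Zmodule.copy ultrapower (Quotient.quot c0U).

Definition ultra_class (x : ell_infty V) : ultrapower :=
  \pi_(Quotient.quot c0U) x.

Definition ultra_repr (q : ultrapower) : ell_infty V :=
  repr (q : Quotient.quot c0U).

Lemma ultra_reprK : cancel ultra_repr ultra_class.
Proof. by move=> q; exact: reprK. Qed.

Lemma ultra_classE x y : ultra_class x = ultra_class y <-> x - y \in c0U.
Proof. by rewrite Quotient.idealrBE; split=> /eqP. Qed.

Lemma ultra_classD x y : ultra_class (x + y) = ultra_class x + ultra_class y.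
Proof.
exact: (raddfD (\pi_(Quotient.quot c0U) : ell_infty V -> Quotient.quot c0U)).
Qed.

Definition ultra_scale (a : R) (q : ultrapower) : ultrapower :=
  ultra_class (a *: ultra_repr q).

Lemma ultra_classZ a x : ultra_class (a *: x) = ultra_scale a (ultra_class x).
Proof.
apply/ultra_classE; rewrite -scalerBr; apply: rpredZ.
by apply/ultra_classE; rewrite ultra_reprK.
Qed.

Fact ultra_scaleA a b q :
  ultra_scale a (ultra_scale b q) = ultra_scale (a * b) q.
Proof. by rewrite -(ultra_reprK q) -!ultra_classZ scalerA. Qed.

Fact ultra_scale1 : left_id 1 ultra_scale.
Proof. by move=> q; rewrite -(ultra_reprK q) -!ultra_classZ scale1r. Qed.

Fact ultra_scaleDr : right_distributive ultra_scale +%R.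
Proof.
move=> a p q; rewrite -(ultra_reprK p) -(ultra_reprK q).
by rewrite -!ultra_classZ -!ultra_classD -ultra_classZ scalerDr.
Qed.

Fact ultra_scaleDl q : {morph ultra_scale^~ q : a b / a + b}.
Proof.
move=> a b; rewrite -(ultra_reprK q).
by rewrite -!ultra_classZ -!ultra_classD scalerDl.
Qed.

HB.instance Definition _ := GRing.Zmodule_isLmodule.Build R ultrapower
  ultra_scaleA ultra_scale1 ultra_scaleDr ultra_scaleDl.

Definition ultra_norm (q : ultrapower) : R :=
  lim (`|ultra_repr q n| @[n --> fultra U]).

Lemma ultra_normE x :
  ultra_norm (ultra_class x) = lim (`|x n| @[n --> fultra U]).
Proof.
set y := ultra_repr (ultra_class x).
have /ultra_classE : ultra_class y = ultra_class x by rewrite ultra_reprK.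
move=> /asboolP yx0.
have xc := ultralim_is_cvg x; have yc := ultralim_is_cvg y.
apply/eqP; rewrite -subr_eq0 -normr_eq0; apply/eqP.
have d : `| `|y n| - `|x n| | @[n --> fultra U] -->
    `|ultra_norm (ultra_class x) - lim (`|x n| @[n --> fultra U])|.
  by apply: cvg_norm; exact: cvgB.
have d0 : `| `|y n| - `|x n| | @[n --> fultra U] --> (0 : R).
  apply: (squeeze_cvgr _ (cvg_cst 0) yx0).
  by apply: nearW => n; rewrite normr_ge0/= ler_dist_dist.
exact: (cvg_unique _ d d0).
Qed.

Fact ultra_normD p q : ultra_norm (p + q) <= ultra_norm p + ultra_norm q.
Proof.
rewrite -(ultra_reprK p) -(ultra_reprK q) -ultra_classD !ultra_normE.
have pc := ultralim_is_cvg (ultra_repr p).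
have qc := ultralim_is_cvg (ultra_repr q).
rewrite -limD//; apply: ler_lim; first exact: ultralim_is_cvg.
  exact: is_cvgD.
by apply: nearW => n; exact: ler_normD.
Qed.

Fact ultra_normZ (a : R) q : ultra_norm (a *: q) = `|a| * ultra_norm q.
Proof.
rewrite -(ultra_reprK q) -[a *: _]ultra_classZ !ultra_normE.
have qc := ultralim_is_cvg (ultra_repr q).
apply: cvg_lim => //; under eq_fun do rewrite normrZ.
exact: cvgMr.
Qed.

Fact ultra_norm0_eq0 q : ultra_norm q = 0 -> q = 0.
Proof.
rewrite -(ultra_reprK q) ultra_normE => q0.
rewrite -[RHS](raddf0
  (\pi_(Quotient.quot c0U) : ell_infty V -> Quotient.quot c0U)).
apply/ultra_classE; rewrite subr0; apply/asboolP.
by rewrite -q0; exact: ultralim_is_cvg.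
Qed.

HB.instance Definition _ := Lmodule_isNormed.Build R ultrapower
  ultra_normD ultra_normZ ultra_norm0_eq0.

End Ultrapower.

Definition uniform_slice_D2P {R : realType} (V : normedModType R) : Prop :=
  forall U : free_ultrafilter, slice_D2P (ultrapower U V).

Structure norm_on {R : realType} (V : lmodType R) := NormOn {
  norm_fun :> V -> R;
  norm_onD : forall x y, norm_fun (x + y) <= norm_fun x + norm_fun y;
  norm_onZ : forall (a : R) x, norm_fun (a *: x) = `|a| * norm_fun x;
  norm_on0_eq0 : forall x, norm_fun x = 0 -> x = 0 }.

Definition renormed {R : realType} (V : lmodType R) (N : norm_on V) : Type := V.

Section Renormed.
Context {R : realType} (V : lmodType R) (N : norm_on V).

HB.instance Definition _ := GRing.Lmodule.copy (renormed N) V.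
HB.instance Definition _ := Lmodule_isNormed.Build R (renormed N)
  (@norm_onD R V N) (@norm_onZ R V N) (@norm_on0_eq0 R V N).

End Renormed.

Definition equivalent_norm {R : realType} (X : normedModType R)
    (N : norm_on X) : Prop :=
  exists a b : R, [/\ 0 < a, 0 < b & forall x, a * `|x| <= N x <= b * `|x|].

(* Main.v *)
Require Import Defs.
From HB Require Import structures.
From mathcomp Require Import all_boot all_order all_algebra.
From mathcomp Require Import all_classical all_reals all_analysis.
From mathcomp Require Import ring lra.

Set Implicit Arguments.
Unset Strict Implicit.
Unset Printing Implicit Defensive.

Import Order.TTheory GRing.Theory Num.Theory.
Import numFieldNormedType.Exports.

Local Open Scope classical_set_scope.
Local Open Scope ring_scope.

(** The new unit ball is the closed convex hull of a bounded set made of two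
    kinds of pieces.  Let [T] embed [c0] in [X], let [e_n] be the image of the
    [n]-th unit vector and let [phi_n] be bounded functionals on [X] extending
    the coordinates of [c0]: the Hahn--Banach theorem, proved below as
    [hahn_banach_graph], provides them with a common bound.  Split the indices
    [n >= 1] into infinitely many infinite classes, each with a marked element.

    - The _flat_ piece consists of the [x] at distance at most [1] from the
      copy of [c0] with [|phi_n x| <= 1] for [n >= 1] and [|phi_0 x| <= 1/2].
    - The _bent_ pieces, one for each class, consist of the vectors
      [bend i c = T c + c_r e_0], where [c] is in the unit ball of [c0], is
      supported by the class [i], and [r] is the marked index of that class.

    All [phi_n] are bounded by [1] on these pieces, so [2 e_n] has norm at
    least [2].  A vector of a piece admits infinitely many [n] for which its
    [n]-th coordinate can be moved to [1] and to [-1] without leaving the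
    piece.  The two resulting vectors are at distance [2], and, since the
    signed sums of the [e_n] are bounded, a functional hardly distinguishes
    them from the original vector for most [n].  Such vectors are the far
    centres, [far_center] ([far_center_flat], [far_center_bend]); so are the
    multiples [t e_0] with [|t| <= 1], which are the averages of the bent
    vectors [t (e_0 + e_r)] up to a small error ([far_center_pole]).

    For the uniform property, what matters is that the number of far centres
    whose convex combinations approximate a vector of the ball up to [eps] is
    bounded in terms of [eps] alone.  A vector of norm less than [1] is a flat
    vector plus a sum of multiples [y_i] of bent vectors, at most one in each
    class, with total mass at most [1].  At most [1 / eps] of the masses are at
    least [eps]; the sum of the others is a multiple of [e_0] plus a vector of
    [c0] all of whose coordinates are at most [eps], because the classes are
    disjoint.  This is [bent_uniformly_far_centered].  A bounded number of
    terms survives the passage to an ultrapower, with weights replaced by their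
    limits, and some far centre of the combination then lies in a given slice
    ([uniformly_far_centered_D2P]).

    For small weakly open sets, the inequality [phi_0 x > 1 - t] leaves only
    a little room for the flat part, and the inequalities
    [phi_r x > 1 / k - t] for the marked indices [r] of [k] classes force the
    masses of all classes to be at most about [1 / k].  Hence
    [x = u e_0 + T c + z] with [u] near [1], [|c|] about [1 / k] and [z] small
    ([bent_slab_structure]), so that these inequalities cut out of the ball
    a set of diameter of order [1 / k]. *)

(** * Hahn--Banach extension *)

Section HahnBanach.
Context {R : realType} (V : lmodType R) (p : V -> R).
Hypothesis pD : forall x y, p (x + y) <= p x + p y.
Hypothesis pZ : forall (t : R) x, 0 <= t -> p (t *: x) = t * p x.

(** A partial linear functional is represented by its graph; single-valuedness
    follows from domination, because [p] vanishes at [0]. *)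
Definition dominated_graph (M : set (V * R)) :=
  [/\ M 0, forall (t : R) u v, M u -> M v -> M (t *: u.1 + v.1, t * u.2 + v.2)
    & forall u, M u -> u.2 <= p u.1].

Section OneStep.
Variables (M : set (V * R)) (x0 : V).
Hypothesis Mgood : dominated_graph M.

(** Subadditivity separates the lower bounds from the upper bounds that
    domination imposes on the value at the new vector [x0]. *)
Lemma dominated_graph_gap :
  exists c : R, forall u, M u -> u.2 - p (u.1 - x0) <= c <= p (u.1 + x0) - u.2.
Proof.
have [M0 Mlin Mp] := Mgood.
have sep u v : M u -> M v -> u.2 - p (u.1 - x0) <= p (v.1 + x0) - v.2.
  move=> Mu Mv; have /Mp/= := Mlin 1 _ _ Mu Mv.
  rewrite scale1r mul1r => uvp.
  have := pD (u.1 - x0) (v.1 + x0).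
  by rewrite addrACA (addNr x0) addr0; lra.
pose A := [set u.2 - p (u.1 - x0) | u in M].
have A0 : A !=set0 by exists (0 - p (0 - x0)); exists 0.
have Aub v : M v -> ubound A (p (v.1 + x0) - v.2).
  by move=> Mv _ [u Mu <-]; exact: sep.
exists (sup A) => u Mu; apply/andP; split.
  apply: ub_le_sup; last by exists u.
  by exists (p (u.1 + x0) - u.2); exact: Aub.
by apply: ge_sup => //; exact: Aub.
Qed.

Lemma dominated_graph_extend :
  exists B, [/\ dominated_graph B, M `<=` B & exists c, B (x0, c)].
Proof.
have [M0 Mlin Mp] := Mgood.
have [c cP] := dominated_graph_gap.
have MZ (t : R) u : M u -> M (t *: u.1, t * u.2).
  by move=> Mu; have := Mlin t _ _ Mu M0; rewrite !addr0.
exists [set w | exists t : R,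
  exists2 u, M u & w = (u.1 + t *: x0, u.2 + t * c)].
split; last 2 first.
- by move=> [x a] Mxa; exists 0, (x, a) => //=; rewrite scale0r mul0r !addr0.
- by exists c, 1, 0 => //=; rewrite scale1r mul1r !add0r.
split.
- by exists 0, 0 => //=; rewrite scale0r mul0r !addr0.
- move=> t _ _ [s [u Mu ->]] [s' [v Mv ->]] /=.
  exists (t * s + s'), (t *: u.1 + v.1, t * u.2 + v.2); first exact: Mlin.
  congr pair => /=; last by ring.
  by rewrite scalerDr scalerDl scalerA addrACA.
- move=> _ [t [u Mu ->]] /=.
  have [t0|t0|->] := ltgtP t 0; last by rewrite scale0r mul0r !addr0; exact: Mp.
  + have /cP/andP[/= h _] := MZ (- t)^-1 _ Mu.
    have -> : u.1 + t *: x0 = (- t) *: ((- t)^-1 *: u.1 - x0).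
      rewrite scalerBr scalerA divff ?scale1r ?scaleNr ?opprK//.
      by rewrite oppr_eq0 lt_eqF.
    rewrite pZ; last by rewrite oppr_ge0 ltW.
    move: h; rewrite lerBlDr => h.
    have : (- t) * ((- t)^-1 * u.2) <= - t * (c + p ((- t)^-1 *: u.1 - x0)).
      by rewrite ler_wpM2l// oppr_ge0 ltW.
    rewrite mulrA divff ?oppr_eq0 ?lt_eqF// mul1r. lra.
  + have /cP/andP[/= _ h] := MZ t^-1 _ Mu.
    have -> : u.1 + t *: x0 = t *: (t^-1 *: u.1 + x0).
      by rewrite scalerDr scalerA divff ?scale1r// gt_eqF.
    rewrite pZ; last exact: ltW.
    move: h; rewrite lerBrDr => h.
    have : t * (c + t^-1 * u.2) <= t * p (t^-1 *: u.1 + x0).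
      by rewrite ler_wpM2l// ltW.
    by rewrite mulrDr mulrA divff ?gt_eqF// mul1r; lra.
Qed.

End OneStep.

(** A maximal dominated graph has a total domain, since otherwise
    [dominated_graph_extend] would enlarge it. *)
Theorem hahn_banach_graph (G : set (V * R)) : dominated_graph G ->
  exists f : {linear V -> R^o},
    (forall x, f x <= p x) /\ forall u, G u -> f u.1 = u.2.
Proof.
move=> Ggood.
(* Quantifying over sets whose union with [G] is good lets the empty chain
   have the upper bound [set0]. *)
have [|A [PA Amax]] := @Zorn_bigcup _ (fun H => dominated_graph (G `|` H)).
  move=> F FP Ftot.
  have [Gz Glin Gp] := Ggood; split; first by left.
    move=> t u v [Gu|[H FH Hu]] [Gv|[K FK Kv]].
    + by left; exact: Glin.
    + have [_ L _] := FP _ FK.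
      have [?|?] := L t u v (or_introl Gu) (or_intror Kv); first by left.
      by right; exists K.
    + have [_ L _] := FP _ FH.
      have [?|?] := L t u v (or_intror Hu) (or_introl Gv); first by left.
      by right; exists H.
    + have [HK|KH] := Ftot _ _ FH FK.
        have [_ L _] := FP _ FK.
        have [?|?] := L t u v (or_intror (HK _ Hu)) (or_intror Kv).
          by left.
        by right; exists K.
      have [_ L _] := FP _ FH.
      have [?|?] := L t u v (or_intror Hu) (or_intror (KH _ Kv)); first by left.
      by right; exists H.
  move=> u [/Gp//|[H FH Hu]].
  by have [_ _ ->//] := FP _ FH; right.
set M := G `|` A in PA; have [M0 Mlin Mp] := PA.
have Mtot x : exists a, M (x, a).
  have [B [Bgood MB [c Bc]]] := dominated_graph_extend x PA.
  exists c; apply: contrapT => nMc; apply: (Amax B).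
    split; first by move=> z Az; apply: MB; right.
    by move=> /(_ _ Bc) Ac; apply: nMc; right.
  suff -> : G `|` B = B by [].
  by apply/setUidPr => z Gz; apply: MB; left.
have Mfun x a b : M (x, a) -> M (x, b) -> a = b.
  move=> Ma Mb.
  have p0 : p 0 = 0 by rewrite -(scale0r 0) pZ// mul0r.
  have h a' b' : M (x, a') -> M (x, b') -> b' <= a'.
    move=> Ma' Mb'; have /Mp/= := Mlin (- 1) _ _ Ma' Mb'.
    by rewrite scaleN1r addNr p0; lra.
  by apply/eqP; rewrite eq_le !h.
have [f fM] := choice Mtot.
have flin : linear (f : V -> R^o).
  move=> t x y; apply: (Mfun (t *: x + y)) => //.
  exact: Mlin t (x, f x) (y, f y) (fM x) (fM y).
pose F := HB.pack_for {linear V -> R^o} (f : V -> R^o)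
  (GRing.isLinear.Build R V R^o *:%R f flin).
exists F; split=> [x|[x a] Gxa].
  exact: (Mp _ (fM x)).
by apply: (Mfun x) => //; left.
Qed.

End HahnBanach.

(** * Finite sums and scalars *)

Lemma sum_pad (V : nmodType) (m n : nat) (F : nat -> V) : (m <= n)%N ->
  (forall i, (m <= i)%N -> F i = 0) -> \sum_(i < n) F i = \sum_(i < m) F i.
Proof.
move=> mn F0; rewrite -!(big_mkord predT F) (big_cat_nat (leq0n m) mn)/=.
have -> : \sum_(m <= i < n) F i = 0.
  by rewrite big_nat_cond big1// => i /andP[/andP[mi _] _]; exact: F0.
by rewrite addr0.
Qed.

Lemma sum_nth_padded (V : nmodType) (A : Type) (F : A -> V) (d : A) (L : seq A)
    (K : nat) : (size L <= K)%N -> F d = 0 ->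
  \sum_(i < K) F (nth d L i) = \sum_(a <- L) F a.
Proof.
move=> LK Fd; rewrite (big_nth d) big_mkord.
by rewrite (sum_pad (F := fun i => F (nth d L i)) LK)// => i /(nth_default d)->.
Qed.

Lemma addr_scale1 (R : pzRingType) (V : lmodType R) (z e : V) (u : R) :
  z + u *: e + e = z + (u + 1) *: e.
Proof. by rewrite scalerDl scale1r addrA. Qed.

Lemma subr_scale1 (R : pzRingType) (V : lmodType R) (z e : V) (u : R) :
  z + u *: e - e = z + (u - 1) *: e.
Proof. by rewrite scalerBl scale1r addrA. Qed.

(** * Elements of an ultrapower *)

Section UltrapowerElements.
Context {R : realType} (U : free_ultrafilter) (V : normedModType R).
Local Notation W := (ultrapower U V).
Local Notation cls := (@ultra_class R U V).

Lemma ell_of_bounded (g : nat -> V) (M : R) : (forall n, `|g n| <= M) ->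
  exists x : ell_infty V, forall n, x n = g n.
Proof.
move=> gM; have gP : ell_infty_pred g by apply/asboolP; exists M.
by exists (EllInfty gP).
Qed.

Lemma norm_ultra_class (x : ell_infty V) :
  `|cls x| = lim (`|x n| @[n --> fultra U]).
Proof. exact: ultra_normE. Qed.

Lemma norm_ultra_class_le (x : ell_infty V) (r : R) :
  (forall n, `|x n| <= r) -> `|cls x| <= r.
Proof.
move=> xr; rewrite norm_ultra_class; apply: limr_le.
  exact: ultralim_is_cvg.
exact: nearW.
Qed.

Lemma norm_ultra_class_ge (x : ell_infty V) (r : R) :
  (forall n, r <= `|x n|) -> r <= `|cls x|.
Proof.
move=> xr; rewrite norm_ultra_class; apply: limr_ge.
  exact: ultralim_is_cvg.
exact: nearW.
Qed.

Lemma ultra_class_scale (a : R) (x : ell_infty V) : cls (a *: x) = a *: cls x.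
Proof. exact: ultra_classZ. Qed.

Lemma ultra_class0 : cls 0 = 0.
Proof. by rewrite -[in LHS](scale0r 0) ultra_class_scale scale0r. Qed.

Lemma ultra_classB (x y : ell_infty V) : cls (x - y) = cls x - cls y.
Proof.
by rewrite -[in LHS]scaleN1r ultra_classD ultra_class_scale scaleN1r.
Qed.

Lemma ultra_class_sum (I : Type) (s : seq I) (F : I -> ell_infty V) :
  cls (\sum_(i <- s) F i) = \sum_(i <- s) cls (F i).
Proof. exact: (big_morph _ (@ultra_classD _ U V) ultra_class0). Qed.

Lemma ellDE (x y : ell_infty V) n : (x + y) n = x n + y n.
Proof. by []. Qed.

Lemma ellBE (x y : ell_infty V) n : (x - y) n = x n - y n.
Proof. by []. Qed.

Lemma ellZE (a : R) (x : ell_infty V) n : (a *: x) n = a *: x n.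
Proof. by []. Qed.

Lemma ell_sumE (I : Type) (s : seq I) (F : I -> ell_infty V) n :
  (\sum_(i <- s) F i) n = \sum_(i <- s) F i n.
Proof. exact: (big_morph (fun x : ell_infty V => x n)). Qed.

Lemma ultra_class_eq (x y : ell_infty V) :
  (\forall n \near fultra U, x n = y n) -> cls x = cls y.
Proof.
move=> xy; apply/ultra_classE/asboolP.
apply: (@cvg_trans _ ((fun=> 0 : R) @ fultra U)); last exact: cvg_cst.
apply: near_eq_cvg; apply: filterS xy => n /= xyn.
rewrite -[RHS]/(`|x n - y n|) xyn subrr.
by rewrite normr0.
Qed.

(** The terms of a representative may be replaced by [0] off a set of the
    ultrafilter, so that every term, not only almost every one, is in the open
    ball. *)
Lemma ultra_class_unit_ball (w : W) : `|w| < 1 ->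
  exists2 x, cls x = w & forall n, `|x n| < 1.
Proof.
rewrite -{1}(ultra_reprK w); set x := ultra_repr w.
rewrite norm_ultra_class => x1.
have xU : \forall n \near fultra U, `|x n| < 1.
  exact: (cvgr_lt _ (@ultralim_is_cvg R U V x)).
have [|y yE] := @ell_of_bounded (fun n => if `|x n| < 1 then x n else 0) 1.
  by move=> n; case: ifPn => [/ltW//|_]; rewrite normr0.
exists y; last first.
  by move=> n; rewrite yE; case: ifPn => // _; rewrite normr0.
rewrite -(ultra_reprK w); apply: ultra_class_eq.
by apply: filterS xU => n; rewrite yE => ->.
Qed.

(** Weights that vary along the sequence act on the ultrapower as the single
    scalar to which they converge along the ultrafilter. *)
Lemma ultra_class_scale_seq (l : nat -> R) : (forall n, 0 <= l n <= 1) ->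
  exists c : R, [/\ 0 <= c, l n @[n --> fultra U] --> c &
    forall x y : ell_infty V, (forall n, y n = l n *: x n) ->
      cls y = c *: cls x].
Proof.
move=> l01.
have lP : ell_infty_pred (l : nat -> R^o).
  apply/asboolP; exists 1 => n; have /andP[l0 l1] := l01 n.
  by rewrite ger0_norm.
have /cvg_ex[c lc] := @ultralim_is_cvg R U R^o (EllInfty lP).
have {}lc : l n @[n --> fultra U] --> c.
  have lE : (fun n => `|l n|) = l.
    by apply/funext => n; have /andP[l0 _] := l01 n; rewrite ger0_norm.
  by have : (fun n => `|l n|) @ fultra U --> c := lc; rewrite lE.
exists c; split => //.
  rewrite -(cvg_lim _ lc)//; apply: limr_ge; first by apply/cvg_ex; exists c.
  by apply: nearW => n; have /andP[] := l01 n.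
move=> x y yE; rewrite -ultra_class_scale; apply/ultra_classE/asboolP.
have h : `|l n - c| * `|x| @[n --> fultra U] --> 0 * `|x|.
  apply: cvgMl; rewrite -(normr0 R) -(subrr c); apply: cvg_norm.
  by apply: cvgB => //; exact: cvg_cst.
rewrite mul0r in h; apply: (squeeze_cvgr _ (cvg_cst 0) h).
apply: nearW => n; rewrite normr_ge0/=.
rewrite -[X in `|X| <= _]/(y n - c *: x n) yE -scalerBl normrZ.
by rewrite ler_wpM2l// ell_norm_ge.
Qed.

End UltrapowerElements.

(** * From uniform far centres to the uniform slice diameter two property *)

Section UniformFarPairs.
Context {R : realType}.

(** The usual boundedness condition on [c0]-like sequences: a functional is
    absolutely summable along such a sequence, with a bound depending only on
    [C] and its norm. *)
Definition signs_bounded (V : normedModType R) (C : R) (a : nat -> V) :=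
  forall n (t : nat -> R), (forall j, `|t j| <= 1) ->
    `|\sum_(j < n) t j *: a j| <= C.

(** The points [z + a j + d j] and [z + a j - d j] of the ball are at distance
    at least [2], and a given functional is close on both to its value at [z],
    except for a number of indices [j] controlled by [C].  The condition is
    quantitative so that it passes to ultrapowers. *)
Definition far_center (V : normedModType R) (C : R) (z : V) :=
  exists a d : nat -> V,
    [/\ forall j, `|z + a j + d j| <= 1 /\ `|z + a j - d j| <= 1,
        forall j, 1 <= `|d j|, signs_bounded C a & signs_bounded C d].

(** The number [K] of centres depends on [eps] but not on [x]: this is what
    distinguishes the property of all ultrapowers from that of the space. *)
Definition uniformly_far_centered (V : normedModType R) :=
  exists C : R, forall eps : R, 0 < eps -> exists K : nat,
    forall x : V, `|x| < 1 -> exists (l : 'I_K -> R) (z : 'I_K -> V),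
      [/\ forall i, 0 <= l i, \sum_i l i = 1, forall i, far_center C (z i)
        & `|x - \sum_i l i *: z i| <= eps].

Lemma functionalZ (V : lmodType R) (f : {linear V -> R^o}) (a : R) x :
  f (a *: x) = a * f x :> R.
Proof. exact: linearZ. Qed.

Lemma signs_bounded_norm_le (V : normedModType R) C (a : nat -> V) j :
  signs_bounded C a -> `|a j| <= C.
Proof.
move=> /(_ j.+1 (fun i => (i == j)%:R)); rewrite big_ord_recr/= eqxx scale1r.
rewrite big1 => [|i _]; last by rewrite ltn_eqF ?scale0r.
by rewrite add0r; apply => i; case: (i == j); rewrite ?normr1 ?normr0.
Qed.

Lemma far_center_norm_le (V : normedModType R) C (z : V) :
  far_center C z -> `|z| <= 1 + C.
Proof.
move=> [a [d [zad _ aC _]]]; have [z1 z2] := zad 0%N.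
have za : `|z + a 0%N| <= 1.
  have : `|(z + a 0%N + d 0%N) + (z + a 0%N - d 0%N)| <= 2.
    by apply: (le_trans (ler_normD _ _)); lra.
  rewrite addrACA subrr addr0 -mulr2n -scaler_nat normrZ normr_nat; lra.
have -> : z = (z + a 0%N) - a 0%N by rewrite addrK.
apply: (le_trans (ler_normB _ _)); apply: lerD => //.
exact: signs_bounded_norm_le.
Qed.

(** Choosing for [t j] the sign of [f (a j)] turns the sum of the absolute
    values into the value of [f] at one signed sum. *)
Lemma signs_bounded_functional (V : normedModType R) C (a : nat -> V)
    (f : {linear V -> R^o}) (B : R) n :
  0 <= B -> (forall x, `|f x| <= B * `|x|) -> signs_bounded C a ->
  \sum_(j < n) `|f (a j)| <= B * C.
Proof.
move=> B0 fB aC; pose t j := Num.sg (f (a j)).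
have -> : \sum_(j < n) `|f (a j)| = f (\sum_(j < n) t j *: a j).
  by rewrite linear_sum; apply: eq_bigr => j _; rewrite functionalZ normrEsg.
apply: (le_trans (ler_norm _)); apply: (le_trans (fB _)).
apply: ler_wpM2l => //; apply: aC => j.
by rewrite normr_sg; case: (_ != _).
Qed.

Lemma small_term (u : nat -> R) (C eps : R) : 0 < eps ->
  (forall n, \sum_(j < n) u j <= C) -> exists j, u j < eps.
Proof.
move=> e0 uC; apply: contrapT => nu.
have ue j : eps <= u j by rewrite leNgt; apply/negP => ?; apply: nu; exists j.
have [n Cn] : exists n : nat, C / eps < n%:R.
  exists (Num.truncn (`|C / eps|)).+1.
  by apply: (le_lt_trans (ler_norm _)); exact: truncnS_gt.
have := uC n; rewrite leNgt => /negP; apply.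
rewrite ltr_pdivrMr// in Cn; apply: (lt_le_trans Cn).
have -> : n%:R * eps = \sum_(j < n) eps.
  by rewrite sumr_const card_ord mulr_natl.
exact: ler_sum.
Qed.

Lemma linear_bound (V : normedModType R) (f : {linear V -> R^o}) :
  continuous f -> exists2 B : R, 0 < B & forall x, `|f x| <= B * `|x|.
Proof.
move=> /linear_bounded_continuous/linear_boundedP.
by move=> /pinfty_ex_gt0[B B0 fB]; exists B.
Qed.

Lemma weighted_sum_ge (K : nat) (l u : 'I_K -> R) (g h : R) :
  (forall i, 0 <= l i) -> \sum_i l i = 1 -> h < g ->
  g <= \sum_i l i * u i -> exists i, h <= u i.
Proof.
move=> l0 l1 hg gu; apply: contrapT => nu.
have: \sum_i l i * u i <= \sum_i l i * h.
  apply: ler_sum => i _; apply: ler_wpM2l => //.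
  by rewrite leNgt; apply/negP => /ltW hu; apply: nu; exists i.
by rewrite -mulr_suml l1 mul1r; lra.
Qed.

(** A slice contains a point [w] of the open ball on which the functional is
    well above the threshold.  Represent [w] termwise and write every term as
    an approximate convex combination of [K] far centres; since [K] is fixed,
    [w] is itself an approximate convex combination of [K] classes of sequences
    of far centres, on one of which the functional is nearly as large as on
    [w].  The witnesses [a j] and [d j] of its terms define classes in the
    ultrapower which are still [c0]-like, so for a suitable [j] the functional
    is small on both, and the two far points given by [j] are in the slice. *)
Theorem uniformly_far_centered_D2P (V : normedModType R) :
  uniformly_far_centered V -> uniform_slice_D2P V.
Proof.
move=> [C VC] U [f fcont] alpha alpha0.
pose B1 := @unit_ball R (ultrapower U V); set S := slice _ _ _.
have [B B0 fB'] := linear_bound fcont.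
(* [f] read as a function into [R] instead of the regular module over [R]. *)
pose g (w : ultrapower U V) : R := f w.
have gB w : `|g w| <= B * `|w| by exact: fB'.
have gD : {morph g : x y / x + y} by exact: linearD.
have gsubr : {morph g : x y / x - y} by exact: linearB.
have gZ c w : g (c *: w) = c * g w by exact: functionalZ.
have g0 : g 0 = 0 by exact: linear0.
have gsum (I : finType) (F : I -> ultrapower U V) :
  g (\sum_i F i) = \sum_i g (F i) by exact: (big_morph g).
suff [u [v [Su Sv uv2]]] : exists u v, [/\ S u, S v & 2 <= `|u - v|].
  apply/eqP; rewrite eq_le; apply/andP; split.
    apply: ge_ereal_sup => _ [x Sx [y Sy <-]]; rewrite lee_fin.
    have [x1 _] := Sx; have [y1 _] := Sy; rewrite /unit_ball/= in x1 y1.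
    by apply: (le_trans (ler_normB _ _)); lra.
  apply: (@le_trans _ _ (`|u - v|%:E)); first by rewrite lee_fin.
  by apply: ereal_sup_ubound; exists u => //; exists v.
have supf : has_sup (g @` B1).
  split; first by exists (g 0), 0 => //; rewrite /B1/unit_ball/= normr0.
  exists B => _ [x x1 <-]; apply: (le_trans (ler_norm _)).
  by apply: (le_trans (gB x)); rewrite -[leRHS]mulr1 ler_wpM2l// ltW.
pose sigma := sup (g @` B1).
have a4 : 0 < alpha / 4 by lra.
have [_ [w0 w01 <-] fw0] := sup_adherent a4 supf.
rewrite -/sigma in fw0; rewrite /B1/unit_ball/= in w01.
have SE w : `|w| <= 1 -> sigma - alpha < g w -> S w by [].
have g_signs C' a n : signs_bounded C' a ->
    \sum_(j < n) `|g (a j)| <= B * C'.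
  by apply: (signs_bounded_functional (f := f)) => //; exact: ltW.
clearbody g sigma S.
have [w w1 fw] : exists2 w : ultrapower U V, `|w| < 1 & sigma - alpha / 2 < g w.
  have [t [t0 t2 tB]] : exists t, [/\ 0 < t, t <= 1 / 2 & t * B <= alpha / 4].
    exists (Num.min (1 / 2) (alpha / (4 * B))).
    split; first by rewrite lt_min divr_gt0//= divr_gt0// mulr_gt0.
      by rewrite ge_min lexx.
    rewrite -ler_pdivlMr// ge_min invfM mulrA lexx orbT//.
  exists ((1 - t) *: w0).
    rewrite normrZ ger0_norm; last lra.
    by apply: (@le_lt_trans _ _ ((1 - t) * 1)); [apply: ler_wpM2l; lra|lra].
  rewrite gZ.
  have : t * g w0 <= t * B.
    apply: ler_wpM2l; first exact: ltW.
    apply: (le_trans (ler_norm _)); apply: (le_trans (gB _)).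
    by rewrite -[leRHS]mulr1; apply: ler_wpM2l => //; exact: ltW.
  by lra.
have [x xw x1] := ultra_class_unit_ball w1.
have e0 : 0 < alpha / (8 * B) by rewrite divr_gt0// mulr_gt0.
have [K VK] := VC _ e0.
have {VK} /choice[l /choice[z lzP]] : forall n, exists l z, _ :=
  fun n => VK (x n) (x1 n).
have l0 n i : 0 <= l n i by have [] := lzP n.
have l1 n : \sum_i l n i = 1 by have [] := lzP n.
have xle n : `|x n - \sum_i l n i *: z n i| <= alpha / (8 * B).
  by have [] := lzP n.
have zfar n i : far_center C (z n i) by have [] := lzP n.
have z1 n i : `|z n i| <= 1 + C := far_center_norm_le (zfar n i).
have l01 i n : 0 <= l n i <= 1.
  rewrite l0/= -(l1 n) (bigD1 i)//= lerDl; exact: sumr_ge0.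
have /choice[Z ZE] i : exists y : ell_infty V, forall n, y n = z n i.
  exact: (@ell_of_bounded _ _ (fun n => z n i) (1 + C)).
have /choice[L LP] i := ultra_class_scale_seq U V (l01 i).
have L0 i : 0 <= L i by have [] := LP i.
have L1 : \sum_i L i = 1.
  have lL : \sum_i l n i @[n --> fultra U] --> \sum_i L i.
    by apply: cvg_big => [|i _]; [exact: add_continuous|have [] := LP i].
  have lE : (fun n => \sum_i l n i) = fun=> 1 by apply/funext.
  have l1' : (fun=> 1 : R) @ fultra U --> (1 : R) by exact: cvg_cst.
  rewrite lE in lL.
  exact: (cvg_unique _ lL l1').
have wZ : `|w - \sum_i L i *: ultra_class U (Z i)| <= alpha / (8 * B).
  have /choice[Y YE] i : exists y : ell_infty V, forall n, y n = l n i *: z n i.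
    apply: (@ell_of_bounded _ _ _ (1 + C)) => n; rewrite normrZ.
    have /andP[h0 h1] := l01 i n; rewrite ger0_norm//.
    by rewrite -[leRHS]mul1r ler_pM.
  have -> : \sum_i L i *: ultra_class U (Z i) = ultra_class U (\sum_i Y i).
    rewrite ultra_class_sum; apply: eq_bigr => i _.
    by have [_ _ LE] := LP i; apply/esym/LE => n; rewrite YE ZE.
  rewrite -xw -ultra_classB; apply: norm_ultra_class_le => n.
  rewrite ellBE ell_sumE (eq_bigr _ (fun i _ => YE i n)); exact: xle.
have [i fZ] : exists i, sigma - 3 / 4 * alpha <= g (ultra_class U (Z i)).
  apply: (@weighted_sum_ge _ L _ (sigma - 5 / 8 * alpha)) => //; first lra.
  have := gB (w - \sum_i L i *: ultra_class U (Z i)); rewrite gsubr gsum.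
  have -> : \sum_i g (L i *: ultra_class U (Z i)) =
            \sum_i L i * g (ultra_class U (Z i)).
    by apply: eq_bigr => i _; rewrite gZ.
  have : B * `|w - \sum_i L i *: ultra_class U (Z i)| <= B * (alpha / (8 * B)).
    by apply: ler_wpM2l => //; exact: ltW.
  have -> : B * (alpha / (8 * B)) = alpha / 8.
    by field; rewrite gt_eqF.
  have := ler_norm (g w - \sum_i L i * g (ultra_class U (Z i))).
  by lra.
have /choice[a /choice[d adP]] : forall n, exists a d, _ :=
  fun n => zfar n i.
have aC n : signs_bounded C (a n) by have [] := adP n.
have dC n : signs_bounded C (d n) by have [] := adP n.
have /choice[A AE] j : exists y : ell_infty V, forall n, y n = a n j.
  by apply: (@ell_of_bounded _ _ _ C) => n; exact: signs_bounded_norm_le.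
have /choice[D DE] j : exists y : ell_infty V, forall n, y n = d n j.
  by apply: (@ell_of_bounded _ _ _ C) => n; exact: signs_bounded_norm_le.
have clsC (G : nat -> ell_infty V) (h : nat -> nat -> V) :
    (forall j n, G j n = h n j) -> (forall n, signs_bounded C (h n)) ->
    signs_bounded C (fun j => ultra_class U (G j)).
  move=> GE gC m t t1.
  rewrite (eq_bigr (fun j : 'I_m => ultra_class U (t j *: G j))) => [|j _].
    rewrite -ultra_class_sum; apply: norm_ultra_class_le => n.
    rewrite ell_sumE (eq_bigr (fun j : 'I_m => t j *: h n j)); first exact: gC.
    by move=> j _; rewrite ellZE GE.
  by rewrite ultra_class_scale.
have [j fAD] : exists j, `|g (ultra_class U (A j))| + `|g (ultra_class U (D j))|
    < alpha / 8.
  apply: (@small_term _ (B * C + B * C)); first lra.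
  move=> m; rewrite big_split/=; apply: lerD.
    exact: (g_signs _ (fun j => ultra_class U (A j)) _ (clsC _ _ AE aC)).
  exact: (g_signs _ (fun j => ultra_class U (D j)) _ (clsC _ _ DE dC)).
pose u := ultra_class U (Z i + A j + D j).
pose v := ultra_class U (Z i + A j - D j).
have uE : u = ultra_class U (Z i) + ultra_class U (A j) + ultra_class U (D j).
  by rewrite /u !ultra_classD.
have vE : v = ultra_class U (Z i) + ultra_class U (A j) - ultra_class U (D j).
  by rewrite /v ultra_classB ultra_classD.
have fu : g u = g (ultra_class U (Z i)) + g (ultra_class U (A j)) +
    g (ultra_class U (D j)) by rewrite uE !gD.
have fv : g v = g (ultra_class U (Z i)) + g (ultra_class U (A j)) -
    g (ultra_class U (D j)) by rewrite vE gsubr gD.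
have := ler_norm (g (ultra_class U (D j))).
have := ler_norm (g (ultra_class U (A j))).
have := lerNnormlW (lexx `|g (ultra_class U (D j))|).
have := lerNnormlW (lexx `|g (ultra_class U (A j))|).
move=> hA hD hA' hD'.
exists u, v; split.
- apply: SE; last by rewrite fu; lra.
  apply: norm_ultra_class_le => n; rewrite !ellDE ZE AE DE.
  by have [/(_ j)[]] := adP n.
- apply: SE; last by rewrite fv; lra.
  apply: norm_ultra_class_le => n; rewrite ellBE ellDE ZE AE DE.
  by have [/(_ j)[]] := adP n.
- rewrite /u /v -ultra_classB; apply: norm_ultra_class_ge => n.
  have -> : (Z i + A j + D j - (Z i + A j - D j)) n = 2 *: d n j.
    rewrite ellBE ellBE !ellDE DE opprD opprK addrACA subrr add0r.
    by rewrite scaler_nat mulr2n.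
  rewrite normrZ normr_nat.
  by have [_ /(_ j) + _ _] := adP n; lra.
Qed.

End UniformFarPairs.

(** * Weakly open sets cut out by finitely many functionals *)

Section WeaklyOpen.
Context {R : realType} (V : normedModType R).

(** A supremum topology is finer than each of its components. *)
Lemma weakly_open_gt (f : dual V) (c : R) :
  weakly_open [set x : V | c < (sval f x : R)].
Proof.
rewrite /weakly_open openE => x /= cx.
have /cvg_sup/(_ f) : nbhs (x : weak_topology V) --> (x : weak_topology V).
  exact: cvg_id.
apply; exists [set y : V | c < (sval f y : R)]; split=> //=.
by exists [set r : R^o | c < (r : R)] => //; exact: open_gt.
Qed.

Lemma weakly_open_forall_gt (f : nat -> dual V) (c : nat -> R) (k : nat) :
  weakly_open [set x : V | forall i, (i < k)%N -> c i < (sval (f i) x : R)].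
Proof.
elim: k => [|k IH].
  rewrite (_ : [set x | _] = setT); first exact: openT.
  by apply/seteqP; split.
rewrite (_ : [set x | _] =
    [set x : V | forall i, (i < k)%N -> c i < (sval (f i) x : R)] `&`
    [set x : V | c k < (sval (f k) x : R)]).
  by apply: openI => //; exact: weakly_open_gt.
apply/seteqP; split=> [x h|x [h hk] i] /=.
  by split=> [i ik|]; apply: h => //; exact: ltnW.
by rewrite ltnS leq_eqVlt => /orP[/eqP->|/h].
Qed.

End WeaklyOpen.

(** * Coordinates of the space c0 and a partition into infinite classes *)

Section C0Coordinates.
Context {R : realType}.

(** Coordinates are read in [R], not in the regular module over [R]. *)
Definition coord (c : c0 R) (n : nat) : R := c0_seq c n.

Lemma coordD c d n : coord (c + d) n = coord c n + coord d n.
Proof. by []. Qed.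

Lemma coordZ (t : R) c n : coord (t *: c) n = t * coord c n.
Proof. by []. Qed.

Lemma coordN c n : coord (- c) n = - coord c n.
Proof. by []. Qed.

Lemma coord0 n : coord 0 n = 0.
Proof. by []. Qed.

Lemma coord_sum (I : Type) (s : seq I) (P : pred I) (F : I -> c0 R) n :
  coord (\sum_(i <- s | P i) F i) n = \sum_(i <- s | P i) coord (F i) n.
Proof. exact: (big_morph (fun c => coord c n)). Qed.

Lemma coord_le_norm c n : `|coord c n| <= `|c|.
Proof. exact: (ell_norm_ge (c0_seq c) n). Qed.

Lemma c0_norm_le c (M : R) : (forall n, `|coord c n| <= M) -> `|c| <= M.
Proof. exact: (@ell_norm_le R R^o (c0_seq c)). Qed.

Fact c0_unit_bounded n : ell_infty_pred (fun m => (m == n)%:R : R^o).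
Proof.
by apply/asboolP; exists 1 => m; case: (m == n); rewrite ?normr1 ?normr0.
Qed.

Fact c0_unit_cvg n : c0_pred (EllInfty (c0_unit_bounded n)).
Proof.
apply/asboolP; apply: (@cvg_trans _ ((fun=> 0 : R^o) @ \oo)).
  by apply: near_eq_cvg; exists n.+1 => // m /= nm; rewrite gtn_eqF.
exact: cvg_cst.
Qed.

Definition c0_unit n : c0 R := C0 (c0_unit_cvg n).

Lemma coord_unit n m : coord (c0_unit n) m = (m == n)%:R.
Proof. by []. Qed.

Lemma c0_unit_norm_le1 n : `|c0_unit n| <= 1.
Proof.
apply: c0_norm_le => m; rewrite coord_unit.
by case: eqP; rewrite ?normr1 ?normr0.
Qed.

Lemma c0_signs_norm_le (k : nat -> nat) (t : nat -> R) n : injective k ->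
  (forall j, `|t j| <= 1) -> `|\sum_(j < n) t j *: c0_unit (k j)| <= 1.
Proof.
move=> kinj t1; apply: c0_norm_le => m; rewrite coord_sum.
have [[i mi]|nm] := pselect (exists i : 'I_n, m = k i).
  rewrite (bigD1 i)//= big1 => [|j ji]; rewrite coordZ coord_unit mi.
    by rewrite eqxx mulr1 addr0.
  by rewrite (inj_eq kinj) eq_sym val_eqE (negbTE ji) mulr0.
rewrite big1 ?normr0// => j _; rewrite coordZ coord_unit.
by case: eqP => [mj|_]; [case: nm; exists j|rewrite mulr0].
Qed.

(** The class [i] is made of the indices [code i j], its marked element being
    [code i 0]; the index [0] belongs to no class. *)
Definition code (i j : nat) : nat := (pickle (i, j)).+1.

Definition class_of (n : nat) : option nat :=
  if n is m.+1 then omap fst (unpickle m : option (nat * nat)) else None.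

Lemma class_of_code i j : class_of (code i j) = Some i.
Proof. by rewrite /class_of /code pickleK. Qed.

Lemma code_inj i j i' j' : code i j = code i' j' -> i = i' /\ j = j'.
Proof. by move=> /succn_inj/(pcan_inj pickleK)[]. Qed.

Definition in_class (i : nat) (c : c0 R) :=
  forall n, coord c n != 0 -> class_of n = Some i.

Lemma in_class0 i : in_class i 0.
Proof. by move=> n; rewrite coord0 eqxx. Qed.

Lemma in_classD i c d : in_class i c -> in_class i d -> in_class i (c + d).
Proof.
move=> ci di n; rewrite coordD.
have [->|/ci//] := eqVneq (coord c n) 0; rewrite add0r; exact: di.
Qed.

Lemma in_classZ i t c : in_class i c -> in_class i (t *: c).
Proof. by move=> ci n; rewrite coordZ mulf_eq0 negb_or => /andP[_ /ci]. Qed.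

Lemma in_class_unit i j : in_class i (c0_unit (code i j)).
Proof.
move=> n; rewrite coord_unit; case: (n =P code i j) => [->|_].
  by rewrite class_of_code.
by rewrite eqxx.
Qed.

Lemma in_class_coord0 i c : in_class i c -> coord c 0 = 0.
Proof. by move=> ci; apply/eqP; apply: contraT => /ci. Qed.

(** At each index at most one of the summands has a nonzero coordinate. *)
Lemma in_class_sum_norm_le (m : nat) (P : pred nat) (y : nat -> c0 R) (r : R) :
  0 <= r -> (forall i, in_class i (y i)) ->
  (forall i, (i < m)%N -> P i -> `|y i| <= r) ->
  `|\sum_(i < m | P i) y i| <= r.
Proof.
move=> r0 yi yr; apply: c0_norm_le => n; rewrite coord_sum.
have [[i /andP[Pi yin]]|ny] :=
    pselect (exists i : 'I_m, P i && (coord (y i) n != 0)).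
  rewrite (bigD1 i)//= big1 => [|j /andP[_ ji]].
    by rewrite addr0 (le_trans (coord_le_norm _ _))// yr.
  apply/eqP; apply: contraT => /yi; rewrite (yi _ _ yin) => -[ij].
  by rewrite -val_eqE/= ij eqxx in ji.
rewrite big1 ?normr0// => i Pi; apply/eqP; apply: contraT => yin.
by case: ny; exists i; rewrite Pi.
Qed.

Lemma in_class_sum_coord (m : nat) (y : nat -> c0 R) i j :
  (forall i, in_class i (y i)) -> (forall i, (m <= i)%N -> y i = 0) ->
  coord (\sum_(l < m) y l) (code i j) = coord (y i) (code i j).
Proof.
move=> yi y0; rewrite coord_sum; have [im|mi] := ltnP i m.
  rewrite (bigD1 (Ordinal im))//= big1 ?addr0// => l li.
  apply/eqP; apply: contraT => /yi; rewrite class_of_code => -[il].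
  by rewrite -val_eqE/= il eqxx in li.
rewrite (y0 _ mi) coord0 big1// => l _.
apply/eqP; apply: contraT => /yi; rewrite class_of_code => -[il].
by have := ltn_ord l; rewrite -il ltnNge mi.
Qed.

End C0Coordinates.

(** * Norms as gauges *)

Section GaugeNorm.
Context {R : realType} (X : normedModType R) (G : X -> R -> Prop) (k L : R).
Hypothesis k0 : 0 < k.
Hypothesis G_ge : forall x r, G x r -> k * `|x| <= r.
Hypothesis G_le : forall x, G x (L * `|x|).
Hypothesis GD : forall x y r s, G x r -> G y s -> G (x + y) (r + s).
Hypothesis GZ : forall (t : R) x r, G x r -> G (t *: x) (`|t| * r).

Let gauge_inf x := inf [set r | G x r].

Let gauge_has_inf x : has_inf [set r | G x r].
Proof.
by split; [exists (L * `|x|); exact: G_le|exists (k * `|x|) => r; exact: G_ge].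
Qed.

Let gauge_inf_le x r : G x r -> gauge_inf x <= r.
Proof. by move=> Gxr; apply: ge_inf => //; case: (gauge_has_inf x). Qed.

Let le_gauge_inf x l : (forall r, G x r -> l <= r) -> l <= gauge_inf x.
Proof. by move=> h; apply: lb_le_inf => //; case: (gauge_has_inf x). Qed.

Let gauge_inf_lt x r : gauge_inf x < r -> exists2 s, s < r & G x s.
Proof. by move=> /inf_lt-/(_ (gauge_has_inf x).1)[s Gs sr]; exists s. Qed.

Let gauge_infD x y : gauge_inf (x + y) <= gauge_inf x + gauge_inf y.
Proof.
rewrite -lerBlDl; apply: le_gauge_inf => s Gs.
rewrite lerBlDr -lerBlDl; apply: le_gauge_inf => r Gr.
by rewrite lerBlDr; apply: gauge_inf_le; exact: GD.
Qed.

Let gauge_infZ (t : R) x : gauge_inf (t *: x) = `|t| * gauge_inf x.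
Proof.
have le (u : R) z : u != 0 -> gauge_inf (u *: z) <= `|u| * gauge_inf z.
  move=> u0; rewrite mulrC -ler_pdivrMr ?normr_gt0//.
  apply: le_gauge_inf => r Gr; rewrite ler_pdivrMr ?normr_gt0// mulrC.
  by apply: gauge_inf_le; exact: GZ.
have [->|t0] := eqVneq t 0.
  rewrite scale0r normr0 mul0r; apply/eqP; rewrite eq_le; apply/andP; split.
    by have := G_le 0; rewrite normr0 mulr0; exact: gauge_inf_le.
  by apply: le_gauge_inf => r /G_ge; rewrite normr0 mulr0.
apply/eqP; rewrite eq_le le//=.
rewrite mulrC -ler_pdivlMr ?normr_gt0// mulrC -normfV.
have {1}-> : x = t^-1 *: (t *: x) by rewrite scalerA mulVf// scale1r.
by apply: le; rewrite invr_eq0.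
Qed.

Let gauge_inf_ge x : k * `|x| <= gauge_inf x.
Proof. by apply: le_gauge_inf => r; exact: G_ge. Qed.

Let gauge_inf0_eq0 x : gauge_inf x = 0 -> x = 0.
Proof.
move=> x0; apply/eqP; rewrite -normr_le0 -(pmulr_rle0 _ k0) -x0.
exact: gauge_inf_ge.
Qed.

Lemma gauge_norm : exists N : norm_on X,
  [/\ forall x, k * `|x| <= N x <= L * `|x|,
      forall x r, G x r -> N x <= r
    & forall x r, N x < r -> exists2 s, s < r & G x s].
Proof.
exists (NormOn gauge_infD gauge_infZ gauge_inf0_eq0); split => /=.
- by move=> x; rewrite gauge_inf_ge/= gauge_inf_le.
- exact: gauge_inf_le.
- exact: gauge_inf_lt.
Qed.

End GaugeNorm.

(** * The renorming *)

Section Renorming.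
Context {R : realType} (X : normedModType R) (T : {linear c0 R -> X}).
Context (phi : nat -> {linear X -> R^o}) (b C : R).
Hypothesis b_gt0 : 0 < b.
Hypothesis C_gt0 : 0 < C.
Hypothesis T_le : forall c, `|T c| <= b * `|c|.
Hypothesis phi_le : forall n x, `|phi n x| <= C * `|x|.
Hypothesis phiT : forall n c, phi n (T c) = coord c n.

(** The functionals with values in [R] instead of the regular module. *)
Definition ph n x : R := phi n x.
Definition evec n : X := T (c0_unit n).

Lemma phD n x y : ph n (x + y) = ph n x + ph n y.
Proof. exact: linearD. Qed.

Lemma phZ n t x : ph n (t *: x) = t * ph n x.
Proof. exact: functionalZ. Qed.

Lemma ph_sum n (I : Type) (s : seq I) (P : pred I) (F : I -> X) :
  ph n (\sum_(i <- s | P i) F i) = \sum_(i <- s | P i) ph n (F i).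
Proof. exact: linear_sum. Qed.

Lemma phT n c : ph n (T c) = coord c n.
Proof. exact: phiT. Qed.

Lemma TD c d : T (c + d) = T c + T d.
Proof. exact: linearD. Qed.

Lemma TB c d : T (c - d) = T c - T d.
Proof. exact: linearB. Qed.

Lemma TZ t c : T (t *: c) = t *: T c.
Proof. exact: linearZ. Qed.

Definition weight (n : nat) : R := if n == 0%N then 2 else 1.

Lemma weight_gt0 n : 0 < weight n.
Proof. by rewrite /weight; case: ifP. Qed.

Lemma weight_le2 n : weight n <= 2.
Proof. by rewrite /weight; case: ifP; rewrite ?ler1n. Qed.

(** For [s = 1] this describes the flat piece.  The weight [2] at the index
    [0] keeps [phi_0] at most [1 / 2] there, so that a large value of [phi_0]
    forces a vector of the ball away from the flat piece. *)
Definition flat_gauge (x : X) (s : R) :=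
  (forall n, weight n * `|ph n x| <= s) /\ exists c, `|x - T c| <= s.

Lemma flat_gauge_ge0 x s : flat_gauge x s -> 0 <= s.
Proof. by move=> [_ [c]]; exact: le_trans. Qed.

Lemma flat_gauge_ph n x s : flat_gauge x s -> `|ph n x| <= s.
Proof.
move=> [/(_ n) + _]; apply: le_trans; rewrite ler_peMl//.
by rewrite /weight; case: ifP; rewrite ?ler1n.
Qed.

Lemma flat_gauge_ph0 x s : flat_gauge x s -> 2 * `|ph 0 x| <= s.
Proof. by move=> [/(_ 0%N)]. Qed.

Lemma flat_gauge_le x s s' : s <= s' -> flat_gauge x s -> flat_gauge x s'.
Proof.
move=> ss' [h [c xc]]; split; last by exists c; exact: le_trans ss'.
by move=> n; exact: le_trans (h n) ss'.
Qed.

Lemma flat_gaugeD x y r s :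
  flat_gauge x r -> flat_gauge y s -> flat_gauge (x + y) (r + s).
Proof.
move=> [xr [c xc]] [ys [d yd]]; split=> [n|].
  rewrite phD; apply: le_trans (lerD (xr n) (ys n)).
  by rewrite -mulrDr ler_wpM2l ?ler_normD// ltW// weight_gt0.
exists (c + d); rewrite TD opprD addrACA.
by apply: (le_trans (ler_normD _ _)); exact: lerD.
Qed.

Lemma flat_gaugeZ t x r : flat_gauge x r -> flat_gauge (t *: x) (`|t| * r).
Proof.
move=> [xr [c xc]]; split=> [n|].
  by rewrite phZ normrM mulrCA ler_wpM2l.
by exists (t *: c); rewrite TZ -scalerBr normrZ ler_wpM2l.
Qed.

Lemma flat_gaugeT c s :
  (forall n, weight n * `|coord c n| <= s) -> flat_gauge (T c) s.
Proof.
move=> cs; split=> [n|]; first by rewrite phT.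
exists c; rewrite subrr normr0; apply: le_trans (cs 0%N).
by rewrite mulr_ge0// ltW// weight_gt0.
Qed.

Lemma flat_gauge_normT c : flat_gauge (T c) (2 * `|c|).
Proof.
apply: flat_gaugeT => n; apply: ler_pM; rewrite ?weight_le2 ?coord_le_norm//.
exact/ltW/weight_gt0.
Qed.

Lemma flat_gauge_normT0 c : coord c 0 = 0 -> flat_gauge (T c) `|c|.
Proof.
move=> c00; apply: flat_gaugeT => n; rewrite /weight; case: eqP => [->|_].
  by rewrite c00 normr0 mulr0.
by rewrite mul1r coord_le_norm.
Qed.

(** If [x] is close to [T c], then the coordinates of [c] are close to the
    values [phi_n x], which bounds [c] and thus [x]. *)
Lemma flat_gauge_norm x s :
  flat_gauge x s -> `|x| <= (1 + b * (1 + C)) * s.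
Proof.
move=> xs; have [_ [c xc]] := xs.
have cs : `|c| <= (1 + C) * s.
  apply: c0_norm_le => n; rewrite -phT.
  have -> : T c = x - (x - T c) by rewrite opprB addrC subrK.
  rewrite phD -scaleN1r phZ mulN1r.
  apply: (le_trans (ler_normB _ _)); rewrite mulrDl mul1r; apply: lerD.
    exact: flat_gauge_ph.
  apply: (le_trans (phi_le _ _)); apply: ler_wpM2l => //; exact: ltW.
have -> : x = (x - T c) + T c by rewrite subrK.
apply: (le_trans (ler_normD _ _)); rewrite mulrDl mul1r; apply: lerD => //.
apply: (le_trans (T_le _)); rewrite -mulrA; apply: ler_wpM2l => //; exact: ltW.
Qed.

Lemma flat_gauge_of_norm x : flat_gauge x ((2 * C + 1) * `|x|).
Proof.
split=> [n|]; last first.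
  exists 0; rewrite linear0 subr0 ler_peMl// lerDr mulr_ge0//; exact: ltW.
apply: (@le_trans _ _ (2 * (C * `|x|))).
  apply: ler_pM; rewrite ?weight_le2//; last exact: phi_le.
  exact/ltW/weight_gt0.
by rewrite mulrA ler_wpM2r// lerDl.
Qed.

(** Bending the copy of a class: the coordinate at the marked index is copied
    along [evec 0]. *)
Definition bend (i : nat) (c : c0 R) : X := T c + coord c (code i 0) *: evec 0.

Lemma bendD i c d : bend i (c + d) = bend i c + bend i d.
Proof. by rewrite /bend TD coordD scalerDl addrACA. Qed.

Lemma bendZ i t c : bend i (t *: c) = t *: bend i c.
Proof. by rewrite /bend TZ coordZ scalerDr scalerA. Qed.

Lemma bend0 i : bend i 0 = 0.
Proof. by rewrite /bend linear0 coord0 scale0r addr0. Qed.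

Lemma ph_evec n m : ph n (evec m) = (n == m)%:R.
Proof. by rewrite phT coord_unit. Qed.

Lemma ph_bend n i c :
  ph n (bend i c) = coord c n + coord c (code i 0) * (n == 0%N)%:R.
Proof. by rewrite phD phZ phT ph_evec. Qed.

Lemma norm_bend i c : `|bend i c| <= 2 * b * `|c|.
Proof.
have -> : 2 * b * `|c| = b * `|c| + `|c| * b by ring.
apply: (le_trans (ler_normD _ _)); apply: lerD => //.
rewrite normrZ; apply: ler_pM => //; first exact: coord_le_norm.
apply: (le_trans (T_le _)); rewrite ler_piMr//; first exact: ltW.
exact: c0_unit_norm_le1.
Qed.

(** The gauge of the convex hull of the flat piece and of the bent pieces:
    the contributions to one class are collected in a single vector [y i].
    The sequence [y] is total, and [0] from [m] on, which makes it possible to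
    add two decompositions of different lengths. *)
Definition bent_gauge (x : X) (r : R) :=
  exists (m : nat) (y : nat -> c0 R) (z : X) (s : R),
  [/\ forall i, in_class i (y i), forall i, (m <= i)%N -> y i = 0,
      x = \sum_(i < m) bend i (y i) + z, flat_gauge z s
    & \sum_(i < m) `|y i| + s <= r].

Lemma bent_gaugeD x x' r r' :
  bent_gauge x r -> bent_gauge x' r' -> bent_gauge (x + x') (r + r').
Proof.
move=> [m [y [z [s [yi y0 -> zs ysr]]]]].
move=> [m' [y' [z' [s' [yi' y0' -> zs' ysr']]]]].
pose M := maxn m m'.
have [mM m'M] : (m <= M)%N /\ (m' <= M)%N by rewrite leq_maxl leq_maxr.
exists M, (fun i => y i + y' i), (z + z'), (s + s'); split.
- by move=> i; exact: in_classD.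
- by move=> i; rewrite geq_max => /andP[/y0-> /y0'->]; rewrite addr0.
- rewrite (eq_bigr (fun i : 'I_M => bend i (y i) + bend i (y' i))) => [|i _].
    rewrite [X in _ = X + _]big_split/= addrACA; congr (_ + _ + _).
      rewrite (sum_pad (F := fun i => bend i (y i)) mM)// => i /y0->.
      exact: bend0.
    rewrite (sum_pad (F := fun i => bend i (y' i)) m'M)// => i /y0'->.
    exact: bend0.
  exact: bendD.
- exact: flat_gaugeD.
- apply: le_trans (lerD ysr ysr'); rewrite addrACA lerD2r.
  rewrite -(sum_pad (F := fun i => `|y i|) mM) => [|i /y0->]; last first.
    by rewrite normr0.
  rewrite -(sum_pad (F := fun i => `|y' i|) m'M) => [|i /y0'->]; last first.
    by rewrite normr0.
  by rewrite -big_split/=; apply: ler_sum => i _; exact: ler_normD.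
Qed.

Lemma bent_gaugeZ t x r : bent_gauge x r -> bent_gauge (t *: x) (`|t| * r).
Proof.
move=> [m [y [z [s [yi y0 -> zs ysr]]]]].
exists m, (fun i => t *: y i), (t *: z), (`|t| * s); split.
- by move=> i; exact: in_classZ.
- by move=> i /y0->; rewrite scaler0.
- rewrite scalerDr scaler_sumr; congr (_ + _).
  by apply: eq_bigr => i _; rewrite bendZ.
- exact: flat_gaugeZ.
- rewrite (eq_bigr (fun i : 'I_m => `|t| * `|y i|)) => [|i _]; last first.
    exact: normrZ.
  by rewrite -mulr_sumr -mulrDr ler_wpM2l.
Qed.

Lemma bent_gauge_flat x s : flat_gauge x s -> bent_gauge x s.
Proof.
move=> xs; exists 0%N, (fun=> 0), x, s.
by split=> //; rewrite ?big_ord0 ?add0r// => i; exact: in_class0.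
Qed.

Lemma bent_gauge_bend i c : in_class i c -> bent_gauge (bend i c) `|c|.
Proof.
move=> ci; exists i.+1, (fun k => if k == i then c else 0), 0, 0; split.
- by move=> k; case: eqP => [->//|_]; exact: in_class0.
- by move=> k ik; rewrite gtn_eqF.
- rewrite big_ord_recr/= eqxx big1 ?addr0 ?add0r// => k _.
  by rewrite ltn_eqF// bend0.
- have := flat_gauge_of_norm 0; by rewrite normr0 mulr0.
- rewrite big_ord_recr/= eqxx big1 ?addr0 ?add0r// => k _.
  by rewrite ltn_eqF// normr0.
Qed.

(** On a bent vector the value of [phi_0] is the coordinate at the marked index,
    hence at most the norm, and elsewhere [phi_n] is the [n]-th coordinate. *)
Lemma bent_gauge_ph n x r : bent_gauge x r -> `|ph n x| <= r.
Proof.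
move=> [m [y [z [s [yi y0 -> zs]]]]]; apply: le_trans.
rewrite phD; apply: (le_trans (ler_normD _ _)); apply: lerD; last first.
  exact: flat_gauge_ph.
rewrite ph_sum; apply: (le_trans (ler_norm_sum _ _ _)); apply: ler_sum => i _.
rewrite ph_bend; case: eqP => [->|_]; last by rewrite mulr0 addr0 coord_le_norm.
by rewrite (in_class_coord0 (yi i)) add0r mulr1 coord_le_norm.
Qed.

(** A common bound, for a gauge equal to [1], of the constants [2 * b] of
    [norm_bend] and [1 + b * (1 + C)] of [flat_gauge_norm]. *)
Definition norm_const : R := 1 + b * (3 + C).

Lemma norm_const_gt0 : 0 < norm_const.
Proof. by rewrite /norm_const ltr_wpDr// mulr_ge0 ?addr_ge0// ltW. Qed.

Lemma bent_gauge_ge x r : bent_gauge x r -> norm_const^-1 * `|x| <= r.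
Proof.
move=> [m [y [z [s [yi y0 -> zs ysr]]]]].
rewrite ler_pdivrMl ?norm_const_gt0//.
apply: (@le_trans _ _ (norm_const * (\sum_(i < m) `|y i| + s))); last first.
  by rewrite ler_wpM2l// ltW// norm_const_gt0.
have Cb : 0 <= b * C by rewrite mulr_ge0// ltW.
rewrite mulrDr; apply: (le_trans (ler_normD _ _)); apply: lerD.
  apply: (le_trans (ler_norm_sum _ _ _)); rewrite mulr_sumr.
  apply: ler_sum => i _.
  apply: (le_trans (norm_bend _ _)); apply: ler_wpM2r => //.
  rewrite /norm_const; move: Cb b_gt0; lra.
apply: (le_trans (flat_gauge_norm zs)); apply: ler_wpM2r.
  exact: flat_gauge_ge0 zs.
rewrite /norm_const; move: Cb b_gt0; lra.
Qed.

Lemma bent_norm : exists N : norm_on X,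
  [/\ forall x, norm_const^-1 * `|x| <= N x <= (2 * C + 1) * `|x|,
      forall x r, bent_gauge x r -> N x <= r
    & forall x r, N x < r -> exists2 s, s < r & bent_gauge x s].
Proof.
apply: gauge_norm.
- by rewrite invr_gt0 norm_const_gt0.
- exact: bent_gauge_ge.
- by move=> x; apply: bent_gauge_flat; exact: flat_gauge_of_norm.
- exact: bent_gaugeD.
- exact: bent_gaugeZ.
Qed.

Section BentNorm.
Variable N : norm_on X.
Hypothesis N_le : forall x r, bent_gauge x r -> N x <= r.
Hypothesis N_lt : forall x r, N x < r -> exists2 s, s < r & bent_gauge x s.

Lemma ph_le_bent n x : `|ph n x| <= N x.
Proof.
rewrite leNgt; apply/negP => /N_lt[s sx /(bent_gauge_ph n)].
by rewrite leNgt sx.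
Qed.

Lemma bent_evec_ge n : 1 <= N (evec n).
Proof. by have := ph_le_bent n (evec n); rewrite ph_evec eqxx normr1. Qed.

Lemma bent_signs_bounded (u : nat -> R) (k : nat -> nat) : injective k ->
  (forall j, `|u j| <= 1) ->
  @signs_bounded R (renormed N) 2 (fun j => u j *: evec (k j)).
Proof.
move=> kinj u1 n t t1.
rewrite -[leLHS]/(N (\sum_(j < n) t j *: (u j *: evec (k j)))).
have -> : \sum_(j < n) t j *: (u j *: evec (k j)) =
    T (\sum_(j < n) (t j * u j) *: c0_unit (k j)).
  rewrite linear_sum; apply: eq_bigr => j _; by rewrite TZ scalerA.
apply: le_trans (N_le (bent_gauge_flat (flat_gauge_normT _))) _.
rewrite -[leRHS]mulr1 ler_wpM2l//.
apply: (@c0_signs_norm_le _ _ (fun j => t j * u j)) => // j.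
by rewrite normrM mulr_ile1.
Qed.

(** Both perturbations are multiples of distinct [evec]s, whose signed sums are
    images of vectors of the unit ball of [c0]; the constant [2] is the largest
    [weight]. *)
Lemma far_center_evec (z : X) (k k' : nat -> nat) (u : nat -> R) :
  injective k -> injective k' -> (forall j, `|u j| <= 1) ->
  (forall j, N (z + u j *: evec (k j) + evec (k' j)) <= 1) ->
  (forall j, N (z + u j *: evec (k j) - evec (k' j)) <= 1) ->
  @far_center R (renormed N) 2 z.
Proof.
move=> kinj kinj' u1 zp zm.
exists (fun j => u j *: evec (k j)), (fun j => evec (k' j)); split.
- by move=> j; split; [exact: zp|exact: zm].
- by move=> j; exact: bent_evec_ge.
- exact: bent_signs_bounded.
- have := @bent_signs_bounded (fun=> 1) k' kinj'.
  under eq_fun do rewrite scale1r.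
  by apply => j; rewrite normr1.
Qed.

(** The flat piece is stable under changes of one coordinate at a nonzero index
    within the interval from [-1] to [1]: the distance to the copy of [c0] does
    not change. *)
Lemma flat_gauge_shift z n (w : R) : n != 0%N -> flat_gauge z 1 ->
  `|ph n z + w| <= 1 -> flat_gauge (z + w *: evec n) 1.
Proof.
move=> n0 [z1 [c zc]] w1; split=> [m|].
  rewrite phD phZ ph_evec; case: (eqVneq m n) => [->|_].
    by rewrite mulr1 /weight (negbTE n0) mul1r.
  by rewrite mulr0 addr0.
exists (c + w *: c0_unit n); rewrite TD TZ opprD addrACA subrr addr0.
exact: zc.
Qed.

(** The coordinate at [j.+1] is replaced by [1] and by [-1]. *)
Lemma far_center_flat z : flat_gauge z 1 -> @far_center R (renormed N) 2 z.
Proof.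
move=> z1; apply: (@far_center_evec z S S (fun j => - ph j.+1 z)).
- exact: succn_inj.
- exact: succn_inj.
- by move=> j; rewrite normrN; exact: flat_gauge_ph.
- move=> j; rewrite addr_scale1.
  apply/N_le/bent_gauge_flat/flat_gauge_shift => //.
  by rewrite addrA subrr add0r normr1.
- move=> j; rewrite subr_scale1.
  apply/N_le/bent_gauge_flat/flat_gauge_shift => //.
  by rewrite addrA subrr add0r normrN normr1.
Qed.

Lemma bend_unit i j :
  bend i (c0_unit (code i j)) = evec (code i j) + (j == 0%N)%:R *: evec 0.
Proof.
rewrite /bend coord_unit; congr (_ + _ *: _); congr (_%:R); congr nat_of_bool.
by apply/eqP/eqP => [/code_inj[_ ->]|->].
Qed.

(** The unmarked coordinates of the class are replaced by [1] and by [-1]; this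
    leaves the component along [evec 0] unchanged. *)
Lemma far_center_bend i c : in_class i c -> `|c| <= 1 ->
  @far_center R (renormed N) 2 (bend i c).
Proof.
move=> ci c1; pose k j := code i j.+1.
have shift (j : nat) (w : R) : `|coord c (k j) + w| <= 1 ->
    N (bend i c + w *: evec (k j)) <= 1.
  move=> w1; have -> : bend i c + w *: evec (k j) =
      bend i (c + w *: c0_unit (k j)).
    by rewrite bendD bendZ bend_unit scale0r addr0.
  have ci' : in_class i (c + w *: c0_unit (k j)).
    by apply: in_classD => //; apply: in_classZ; exact: in_class_unit.
  apply: le_trans (N_le (bent_gauge_bend ci')) _; apply: c0_norm_le => n.
  rewrite coordD coordZ coord_unit; case: (eqVneq n (k j)) => [->|_].
    by rewrite mulr1.
  by rewrite mulr0 addr0 (le_trans (coord_le_norm _ _)).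
have kinj : injective k by move=> j j' /code_inj[_ /succn_inj].
apply: (@far_center_evec _ k k (fun j => - coord c (k j))) => //.
- by move=> j; rewrite normrN (le_trans (coord_le_norm _ _)).
- move=> j; rewrite addr_scale1; apply: shift.
  by rewrite addrA subrr add0r normr1.
- move=> j; rewrite subr_scale1; apply: shift.
  by rewrite addrA subrr add0r normrN normr1.
Qed.

(** Here the centre is approached along infinitely many classes: the bent
    vector [t (e_0 + e_r)], where [r] is the marked index of the class [j], is
    perturbed at the next index of the same class. *)
Lemma far_center_pole t : `|t| <= 1 ->
  @far_center R (renormed N) 2 (t *: evec 0).
Proof.
move=> t1.
have tw (j : nat) (w : R) : `|w| <= 1 ->
    N (t *: evec 0 + t *: evec (code j 0) + w *: evec (code j 1)) <= 1.
  move=> w1; pose c := t *: c0_unit (code j 0) + w *: c0_unit (code j 1).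
  have -> : t *: evec 0 + t *: evec (code j 0) + w *: evec (code j 1) =
      bend j c.
    rewrite /c bendD !bendZ !bend_unit/= scale0r addr0 scale1r scalerDr.
    by rewrite (addrC (t *: evec 0)).
  have cj : in_class j c.
    by apply: in_classD; apply: in_classZ; exact: in_class_unit.
  apply: le_trans (N_le (bent_gauge_bend cj)) _; apply: c0_norm_le => n.
  rewrite coordD !coordZ !coord_unit.
  case: (eqVneq n (code j 0)) => [->|_]; last first.
    by rewrite mulr0 add0r; case: eqP; rewrite ?mulr1 ?mulr0 ?normr0.
  case: eqP => [/code_inj[]//|_]; by rewrite mulr1 mulr0 addr0.
apply: (@far_center_evec _ (code^~ 0%N) (code^~ 1%N) (fun=> t)) => //.
- by move=> j j' /code_inj[].
- by move=> j j' /code_inj[].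
- by move=> j; have := tw j 1; rewrite scale1r normr1; exact.
- by move=> j; have := tw j (- 1); rewrite scaleN1r normrN normr1; exact.
Qed.

(** Among the masses of a decomposition at most [1 / eps] are at least [eps]
    and give one centre each.  The other classes contribute a multiple of
    [evec 0], which is one more centre, up to an error all of whose coordinates
    are at most [eps].  The flat part is the last centre. *)
Lemma bent_uniformly_far_centered : @uniformly_far_centered R (renormed N).
Proof.
exists 2 => eps eps0; pose K := (Num.truncn eps^-1).+2; exists K => x x1.
have [r r1 [m [y [z [s [yi y0 xE zs ysr]]]]]] := N_lt x1.
pose S := [seq i <- iota 0 m | eps <= `|y i|].
pose sigma := \sum_(i < m) `|y i|; rewrite -/sigma in ysr.
have s0 := flat_gauge_ge0 zs.
have sigma1 : 0 < 1 - sigma by lra.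
pose mu := \sum_(i < m | ~~ (eps <= `|y i|)) `|y i|.
pose tau := \sum_(i < m | ~~ (eps <= `|y i|)) coord (y i) (code i 0).
have taumu : `|tau| <= mu.
  apply: (le_trans (ler_norm_sum _ _ _)); apply: ler_sum => i _.
  exact: coord_le_norm.
have mu0 : 0 <= mu by exact: le_trans taumu.
have sumS (V : nmodType) (F : nat -> V) :
    \sum_(i <- S) F i = \sum_(i < m | eps <= `|y i|) F i.
  by rewrite big_filter -[in iota 0 m](subn0 m) big_mkord.
have bigsmall (V : nmodType) (F : nat -> V) : \sum_(i < m) F i =
    \sum_(i <- S) F i + \sum_(i < m | ~~ (eps <= `|y i|)) F i.
  by rewrite sumS (bigID (fun i : 'I_m => eps <= `|y i|)).
have sizeS : (size S <= Num.truncn eps^-1)%N.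
  rewrite truncn_ge_nat; last by rewrite invr_ge0 ltW.
  rewrite -[leRHS]mul1r ler_pdivlMr// mulr_natl -iter_addr_0 -count_predT.
  rewrite -big_const_seq.
  apply: (@le_trans _ _ (\sum_(i <- S) `|y i|)); last first.
    apply: (@le_trans _ _ sigma); last lra.
    by rewrite /sigma (bigsmall _ (fun i => `|y i|)) lerDl.
  rewrite big_seq [leRHS]big_seq; apply: ler_sum => i.
  by rewrite mem_filter => /andP[].
(* The weight of the flat part is everything left by the masses, so that the
   weights add up to [1]; [pole] is [0] when [mu] vanishes, as is [tau]. *)
pose pole := tau / mu; pose rest := (1 - sigma)^-1 *: z.
pose L : seq (R * X) := [seq (`|y i|, `|y i|^-1 *: bend i (y i)) | i <- S] ++
  [:: (mu, pole *: evec 0); (1 - sigma, rest)].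
have LK : (size L <= K)%N by rewrite size_cat size_map addn2 !ltnS.
have far_rest : @far_center R (renormed N) 2 rest.
  apply: far_center_flat.
  have s_le : s <= 1 - sigma by lra.
  have := flat_gaugeZ (1 - sigma)^-1 (flat_gauge_le s_le zs).
  by rewrite ger0_norm ?invr_ge0 1?ltW// mulVf// gt_eqF.
have normL (i : nat) : (i \in S) -> 0 < `|y i|.
  by rewrite mem_filter => /andP[/(lt_le_trans eps0)].
(* The list is padded with far centres of weight [0] up to the length [K]. *)
have sumL (V : nmodType) (F : R * X -> V) : F (0, rest) = 0 ->
    \sum_(i < K) F (nth (0, rest) L i) =
    \sum_(i <- S) F (`|y i|, `|y i|^-1 *: bend i (y i)) +
      (F (mu, pole *: evec 0) + F (1 - sigma, rest)).
  move=> F0; rewrite sum_nth_padded// big_cat/= big_map; congr (_ + _).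
  by rewrite !big_cons big_nil addr0.
have Lfar a : a \in (0, rest) :: L ->
    0 <= a.1 /\ @far_center R (renormed N) 2 a.2.
  rewrite inE mem_cat !inE.
  case/or4P => [/eqP->|/mapP[i iS ->]|/eqP->|/eqP->]; split=> //=; last 2 first.
  - apply: far_center_pole; rewrite normrM normfV (ger0_norm mu0).
    have [->|mu_neq0] := eqVneq mu 0; first by rewrite invr0 mulr0.
    by rewrite ler_pdivrMr ?mul1r// lt_def mu_neq0.
  - exact: ltW.
  rewrite -bendZ; apply: far_center_bend; first exact: in_classZ.
  by rewrite normrZ normfV normr_id mulVf// gt_eqF// normL.
have nthL i : nth (0, rest) L i \in (0, rest) :: L.
  have [iL|Li] := ltnP i (size L); last by rewrite nth_default// mem_head.
  by rewrite inE mem_nth ?orbT.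
exists (fun i : 'I_K => (nth (0, rest) L i).1).
exists (fun i => (nth (0, rest) L i).2).
split.
- by move=> i; have [] := Lfar _ (nthL i).
- rewrite (sumL _ (fun a => a.1))//= addrA -(bigsmall _ (fun i => `|y i|)).
  by rewrite -/sigma addrC subrK.
- by move=> i; have [] := Lfar _ (nthL i).
- rewrite -[leLHS]/(N (x - \sum_(i < K)
    (nth (0, rest) L i).1 *: (nth (0, rest) L i).2)).
  rewrite (sumL _ (fun a => a.1 *: a.2)) /=; last by rewrite scale0r.
  rewrite (_ : \sum_(i <- S) _ = \sum_(i <- S) bend i (y i)); last first.
    rewrite big_seq [RHS]big_seq; apply: eq_bigr => i /normL yi0.
    by rewrite scalerA divff ?scale1r// gt_eqF.
  have -> : mu *: (pole *: evec 0) = tau *: evec 0.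
    rewrite scalerA; congr (_ *: _); rewrite /pole.
    have [mu00|mu_neq0] := eqVneq mu 0; last by rewrite mulrC divfK.
    by move: taumu; rewrite mu00 mul0r normr_le0 => /eqP.
  have -> : (1 - sigma) *: rest = z by rewrite scalerA divff ?scale1r ?gt_eqF.
  pose c := \sum_(i < m | ~~ (eps <= `|y i|)) y i.
  have -> : x - (\sum_(i <- S) bend i (y i) + (tau *: evec 0 + z)) = T c.
    rewrite xE (bigsmall _ (fun i => bend i (y i))).
    have -> : \sum_(i < m | ~~ (eps <= `|y i|)) bend i (y i) =
        T c + tau *: evec 0.
      by rewrite big_split/= scaler_suml linear_sum.
    apply/eqP; rewrite subr_eq; apply/eqP; rewrite !addrA; congr (_ + _ + _).
    exact: addrC.
  have c0E : coord c 0 = 0.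
    by rewrite coord_sum big1// => i _; exact: in_class_coord0 (yi i).
  apply: le_trans (N_le (bent_gauge_flat (flat_gauge_normT0 c0E))) _.
  apply: (@in_class_sum_norm_le _ m (fun i => ~~ (eps <= `|y i|)) y eps) => //.
    exact: ltW.
  move=> i _.
  by rewrite -ltNge => /ltW.
Qed.

(** The value of [phi_0] is at most the mass of the bent part plus half of that
    of the flat part, so its being near [1] makes the flat part small.  Then
    the mass of each of the first [k] classes is at least about [1 / k]; as the
    total is about [1], no class has a mass much larger than [1 / k]. *)
Lemma bent_slab_structure (k : nat) (t : R) (x : X) : (0 < k)%N -> 0 < t ->
  5 * t <= k%:R^-1 -> N x <= 1 -> 1 - t < ph 0 x ->
  (forall i, (i < k)%N -> k%:R^-1 - t < ph (code i 0) x) ->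
  exists (u : R) (c : c0 R) (z : X), [/\ x = u *: evec 0 + T c + z,
    `|u - 1| <= 3 * t, coord c 0 = 0,
    `|c| <= k%:R^-1 + 5 * k%:R * t & flat_gauge z (4 * t)].
Proof.
move=> k0 t0 t5 x1 x0 xk.
have [|r r1 [m [y [z [s [yi y0 xE zs ysr]]]]]] := N_lt (x := x) (r := 1 + t).
  by lra.
pose sigma := \sum_(i < m) `|y i|; rewrite -/sigma in ysr.
pose u := \sum_(i < m) coord (y i) (code i 0).
pose c := \sum_(i < m) y i.
have s0 := flat_gauge_ge0 zs.
have {}xE : x = u *: evec 0 + T c + z.
  rewrite xE; congr (_ + _).
  by rewrite big_split/= scaler_suml linear_sum addrC.
have c00 : coord c 0 = 0.
  by rewrite coord_sum big1// => i _; exact: in_class_coord0 (yi i).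
have usigma : u <= sigma.
  apply: ler_sum => i _; apply: le_trans (ler_norm _) _; exact: coord_le_norm.
have ph0x : ph 0 x = u + ph 0 z.
  by rewrite xE !phD phZ phT ph_evec c00 mulr1 addr0.
have := flat_gauge_ph0 zs; have := ler_norm (ph 0 z) => z0 z0s.
have s4 : s <= 4 * t by lra.
exists u, c, z; split=> //; last exact: flat_gauge_le zs.
  by rewrite ler_norml; apply/andP; split; lra.
have kR0 : 0 < k%:R :> R by rewrite ltr0n.
have mu_big i : (i < k)%N -> k%:R^-1 - 5 * t <= `|y i|.
  move=> ik; have := xk i ik; have phix : ph (code i 0) x =
      coord (y i) (code i 0) + ph (code i 0) z.
    by rewrite xE !phD phZ phT ph_evec mulr0 add0r in_class_sum_coord.
  have := flat_gauge_ph (code i 0) zs.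
  have := ler_norm (ph (code i 0) z).
  have := ler_norm (coord (y i) (code i 0)).
  have := coord_le_norm (y i) (code i 0).
  by lra.
rewrite -[c]/(\sum_(i < m | predT (i : nat)) y i).
have kt0 : 0 <= k%:R * t by rewrite mulr_ge0// ltW.
apply: in_class_sum_norm_le => //.
  by have : 0 < k%:R^-1 :> R by [rewrite invr_gt0]; lra.
move=> i im _.
pose M := maxn m k.
(* [e] is a lower bound of the masses with total almost [1]: the excess of one
   mass over [e] is at most the excess of the total. *)
pose e (l : nat) : R := if (l < k)%N then k%:R^-1 - 5 * t else 0.
have e_le l : e l <= `|y l| by rewrite /e; case: ifP => // /mu_big.
have e_k : \sum_(l < M) e l = 1 - 5 * k%:R * t.
  rewrite (@sum_pad _ k) ?leq_maxr// => [|l kl]; last by rewrite /e ltnNge kl.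
  rewrite (eq_bigr (fun=> k%:R^-1 - 5 * t)) => [|l _]; last first.
    by rewrite /e ltn_ord.
  rewrite sumr_const card_ord -[_ *+ k]mulr_natr.
  by field; rewrite gt_eqF.
have sigmaE : sigma = \sum_(l < M) `|y l|.
  rewrite (@sum_pad _ m _ (fun l => `|y l|)) ?leq_maxl// => l /y0->.
  by rewrite normr0.
have iM : (i < M)%N by rewrite (leq_trans im)// leq_maxl.
have : `|y i| - e i <= sigma - (1 - 5 * k%:R * t).
  rewrite sigmaE -e_k -sumrB (bigD1 (Ordinal iM))//= lerDl.
  by apply: sumr_ge0 => l _; rewrite subr_ge0.
have : e i <= k%:R^-1 - 5 * t by rewrite /e; case: ifP => //; lra.
by lra.
Qed.

(** The same functional, on the space with the new norm. *)
Definition phi_renormed n : {linear (renormed N) -> R^o} := phi n.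

Lemma phi_continuous n : continuous (phi_renormed n).
Proof.
apply/linear_bounded_continuous/linear_boundedP.
near=> r => x; apply: (le_trans (ph_le_bent n x)).
rewrite -[leLHS]/(`|x : renormed N|) ler_peMl//.
Unshelve. all: by end_near. Qed.

Definition phi_dual n : dual (renormed N) :=
  exist _ (phi_renormed n) (@phi_continuous n).

(** Two points of the slab given by [bent_slab_structure] differ by a vector of
    the copy of [c0] with small coordinates and a small flat vector. *)
Lemma bent_small_weakly_open eta : 0 < eta ->
  exists A : set (renormed N),
    [/\ rel_weakly_open (@unit_ball R (renormed N)) A,
        A !=set0
      & (diam A < eta%:E)%E].
Proof.
move=> eta0; pose k := (Num.truncn (3 / eta)).+1; pose kk : R := k%:R^-1.
have kR0 : 0 < k%:R :> R by rewrite ltr0n.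
have kk0 : 0 < kk by rewrite invr_gt0.
have kk1 : kk <= 1 by rewrite invf_le1// ler1n.
have keta : 3 * kk < eta.
  rewrite /kk ltr_pdivrMr// mulrC -ltr_pdivrMr//; exact: truncnS_gt.
have [t [t0 t5 kt]] : exists t,
    [/\ 0 < t, 20 * t <= kk & 20 * (k%:R * t) <= kk].
  exists (kk / 20 * kk); split; first by rewrite !mulr_gt0.
    nra.
  rewrite (_ : 20 * (k%:R * (kk / 20 * kk)) = k%:R * kk * kk); last by field.
  by rewrite /kk mulfV ?gt_eqF// mul1r.
pose f (i : nat) := if i is j.+1 then phi_dual (code j 0) else phi_dual 0.
pose cut (i : nat) : R := if i is j.+1 then kk - t else 1 - t.
pose W := [set x : renormed N |
  forall i, (i < k.+1)%N -> cut i < (sval (f i) x : R)].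
exists (W `&` @unit_ball R (renormed N)); split.
- by exists W => //; exact: weakly_open_forall_gt.
(* The barycentre of the vectors [e_0 + e_r], where [r] runs over the marked
   indices of the first [k] classes, satisfies all the inequalities. *)
- pose y i := if (i < k)%N then kk *: c0_unit (code i 0) else 0 : c0 R.
  have yi i : in_class i (y i).
    rewrite /y; case: ifP => _; last exact: in_class0.
    by apply: in_classZ; exact: in_class_unit.
  have y0 i : (k <= i)%N -> y i = 0 by rewrite /y ltnNge => ->.
  have ycode i : (i < k)%N -> coord (y i) (code i 0) = kk.
    by move=> ik; rewrite /y ik coordZ coord_unit eqxx mulr1.
  have kkk : k%:R * kk = 1 by rewrite /kk mulfV// gt_eqF.
  exists (\sum_(i < k) bend i (y i)); split; last first.
    apply: N_le; exists k, y, 0, 0; split => //; first by rewrite addr0.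
      by have := flat_gauge_of_norm 0; rewrite normr0 mulr0.
    rewrite addr0 -kkk mulr_natl -[k in leRHS]card_ord -sumr_const.
    apply: ler_sum => i _; rewrite /y ltn_ord normrZ gtr0_norm// ler_piMr//.
      exact: ltW.
    exact: c0_unit_norm_le1.
  move=> [_|i]; rewrite /= -/(ph _ _) ph_sum.
    rewrite (eq_bigr (fun=> kk)) => [|i _].
      by rewrite sumr_const card_ord -mulr_natl kkk; lra.
    rewrite [LHS]ph_bend mulr1 ycode// (in_class_coord0 (yi i)) add0r//.
  rewrite ltnS => ik.
  rewrite (eq_bigr (fun l : 'I_k => coord (y l) (code i 0))).
    rewrite -coord_sum in_class_sum_coord// ycode//; lra.
  by move=> l _; rewrite ph_bend mulr0 addr0.
- apply: (@le_lt_trans _ _ (3 * kk)%:E); last by rewrite lte_fin.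
  apply: ge_ereal_sup => _ [x [xW x1] [x' [x'W x'1] <-]]; rewrite lee_fin.
  have struct (w : X) : W w -> N w <= 1 ->
    exists (u : R) (c : c0 R) (z : X), [/\ w = u *: evec 0 + T c + z,
      `|u - 1| <= 3 * t, coord c 0 = 0,
      `|c| <= kk + 5 * k%:R * t & flat_gauge z (4 * t)].
    move=> wW w1; apply: bent_slab_structure => //; first by rewrite -/kk; lra.
      exact: (wW 0%N).
    by move=> i ik; exact: (wW i.+1).
  have [u [c [z [-> u1 c00 c1 z1]]]] := struct x xW x1.
  have [u' [c' [z' [-> u1' c00' c1' z1']]]] := struct x' x'W x'1.
  rewrite -[leLHS]/(N (u *: evec 0 + T c + z - (u' *: evec 0 + T c' + z'))).
  have -> : u *: evec 0 + T c + z - (u' *: evec 0 + T c' + z') =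
      T ((u - u') *: c0_unit 0 + (c - c')) + (z + (-1) *: z').
    rewrite TD TZ TB scaleN1r scalerBl.
    by rewrite opprD addrACA opprD [in LHS](addrACA (u *: evec 0)).
  have zz := flat_gaugeD z1 (flat_gaugeZ (-1) z1').
  apply: (@le_trans _ _
      ((2 * kk + 10 * (k%:R * t)) + (4 * t + `|-1| * (4 * t)))); last first.
    by rewrite normrN1; lra.
  apply/N_le/bent_gauge_flat/flat_gaugeD => //.
  apply: flat_gaugeT => n; rewrite coordD coordZ coordD coordN coord_unit.
  have kt' : t <= k%:R * t by rewrite ler_peMl ?ler1n// ltW.
  have [->|n0] := eqVneq n 0%N.
    rewrite c00 c00' subr0 addr0 mulr1 /weight eqxx.
    have := ler_distD 1 u u'; rewrite (distrC 1); lra.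
  rewrite mulr0 add0r /weight (negbTE n0) mul1r.
  have := coord_le_norm c n; have := coord_le_norm c' n.
  have := ler_normB (coord c n) (coord c' n); lra.
Qed.

End BentNorm.
End Renorming.

(** * The theorem *)

Theorem theorem1p1 (R : realType) (X : completeNormedModType R)
    (hX : contains_isomorphic_copy (c0 R) X) :
  exists N : norm_on X,
    [/\ equivalent_norm N,
        uniform_slice_D2P (renormed N)
      & forall eta : R, 0 < eta ->
          exists A : set (renormed N),
            [/\ rel_weakly_open (@unit_ball R (renormed N)) A,
                A !=set0
              & (diam A < eta%:E)%E]].
Proof.
have [T [a [b [a0 b0 Tab]]]] := hX.
have ai0 : 0 < a^-1 by rewrite invr_gt0.
have T_le c : `|T c| <= b * `|c| by have /andP[] := Tab c.
have norm_le_T c : `|c| <= a^-1 * `|T c|.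
  by rewrite ler_pdivlMl//; have /andP[] := Tab c.
have /choice[phi phiP] : forall n : nat, exists f : {linear X -> R^o},
    (forall x, `|f x| <= a^-1 * `|x|) /\ forall c, f (T c) = coord c n.
  move=> n; pose G := [set w : X * R | exists c, w = (T c, coord c n)].
  have [|||f [fp fG]] := @hahn_banach_graph R X (fun x => a^-1 * `|x|) _ _ G.
  - by move=> x y; rewrite -mulrDr ler_wpM2l ?ler_normD// ltW.
  - by move=> t x t0; rewrite normrZ ger0_norm// mulrCA.
  - split.
    + by exists 0; rewrite linear0 coord0.
    + move=> t _ _ [c ->] [d ->]; exists (t *: c + d) => /=.
      by rewrite linearP coordD coordZ.
    + move=> _ [c ->] /=; apply: le_trans (ler_norm _) _.
      exact: le_trans (coord_le_norm _ _) _.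
  exists f; split=> [x|c]; last by apply: (fG (T c, coord c n)); exists c.
  have := fp x; have := fp (- x); rewrite linearN normrN => h1 h2.
  by rewrite ler_norml h2 andbT lerNl.
have phi_le n x : `|phi n x| <= a^-1 * `|x| by have [] := phiP n.
have phiT n c : phi n (T c) = coord c n by have [] := phiP n.
have [N [N_norm N_le N_lt]] := bent_norm b0 ai0 T_le phi_le phiT.
have M0 := norm_const_gt0 b0 ai0.
have Mi0 : 0 < (norm_const b a^-1)^-1 by rewrite invr_gt0.
exists N; split.
- exists (norm_const b a^-1)^-1, (2 * a^-1 + 1); split => //.
  by rewrite addr_gt0// mulr_gt0.
- apply: uniformly_far_centered_D2P.
  exact: (bent_uniformly_far_centered ai0 phi_le phiT N_le N_lt).
- exact: (bent_small_weakly_open ai0 phi_le phiT N_le N_lt).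
Qed.
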